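(* Let $W_0 = \{ f \in W^{1,2}[0,1] : f(0)=f(1)=0 \}$. If $\phi:(0,1)\to\mathbb{C}$ is a densely defined multiplier for $W_0$, i.e. $D(M_\phi) = \{ f \in W_0 : \phi f \in W_0\}$ is dense in $W_0$, then there exists $f \in D(M_\phi)$ such that $f(x) \neq 0$ for all $x \in (0,1)$.
   Context: $W^{1,2}[0,1]$ denotes the set of functions $f : [0,1] \to \mathbb{C}$ that are absolutely continuous with $f' \in L^2[0,1]$ (actual functions, not equivalence classes), a Hilbert space with inner product $\langle f | g\rangle = \int_0^1 f(x)\overline{g(x)} + f'(x)\overline{g'(x)}\, dx$. $W_0 = \{ f \in W^{1,2}[0,1] : f(0)=f(1)=0 \}$ is a closed subspace carrying the same inner product. Elements of $W_0$ vanish at $0$ and $1$, so $W_0$ is regarded as a Hilbert space of functions on $(0,1)$. For $\phi:(0,1)\to\mathbb{C}$ and $f \in W_0$, ''$\phi f \in W_0$'' means that the function equal to $\phi(x) f(x)$ for $x\in(0,1)$ and to $0$ at $x = 0,1$ belongs to $W_0$. The domain of the multiplication operator $M_\phi f = \phi f$ is $D(M_\phi) = \{ f \in W_0 : \phi f \in W_0 \}$, and $\phi$ is a densely defined multiplier for $W_0$ if $D(M_\phi)$ is dense in $W_0$ in the norm of $W^{1,2}[0,1]$. *)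

(* Defs.v *)
From HB Require Import structures.
From mathcomp Require Import all_boot all_order all_algebra.
From mathcomp Require Import all_classical all_reals all_analysis.
From mathcomp Require Import complex.

Set Implicit Arguments.
Unset Strict Implicit.
Unset Printing Implicit Defensive.

Import Order.TTheory GRing.Theory Num.Theory.
Import numFieldNormedType.Exports.

Local Open Scope classical_set_scope.
Local Open Scope ring_scope.
Local Open Scope complex_scope.

(* A function on [0, 1] (or on (0, 1)) is represented by a total function     *)
(* R -> R[i] whose values elsewhere are irrelevant to all the notions below.  *)
(* [normc] is the R-valued modulus, unlike `|z|, which lies in R[i].          *)

Definition abs_continuous01 (R : realType) (f : R -> R[i]) : Prop :=
  forall e : R, 0 < e -> exists2 d : R, 0 < d &
    forall (n : nat) (a b : 'I_n -> R),
      (forall i, 0 <= a i /\ a i <= b i /\ b i <= 1) ->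
      trivIset [set: 'I_n] (fun i => `]a i, b i[%classic) ->
      \sum_(i < n) (b i - a i) < d ->
      \sum_(i < n) ComplexField.Normc.normc (f (b i) - f (a i)) < e.

(* Complex derivatives, measurability and integrals of functions of a real    *)
(* variable are taken componentwise.                                          *)
Definition cderivable (R : realType) (f : R -> R[i]) (x : R) : Prop :=
  derivable (fun t => complex.Re (f t)) x 1 /\
  derivable (fun t => complex.Im (f t)) x 1.

Definition cderive (R : realType) (f : R -> R[i]) (x : R) : R[i] :=
  derive1 (fun t => complex.Re (f t)) x +i*
  derive1 (fun t => complex.Im (f t)) x.

Definition cintegral01 (R : realType) (f : R -> R[i]) : R[i] :=
  Rintegral lebesgue_measure `[0, 1]%classic (fun x => complex.Re (f x)) +i*
  Rintegral lebesgue_measure `[0, 1]%classic (fun x => complex.Im (f x)).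

Definition square_integrable01 (R : realType) (f : R -> R[i]) : Prop :=
  [/\ measurable_fun `[0 : R, 1 : R]%classic (fun x => complex.Re (f x)),
      measurable_fun `[0 : R, 1 : R]%classic (fun x => complex.Im (f x)) &
      (\int[lebesgue_measure]_(x in `[0%R, 1%R])
         ((ComplexField.Normc.normc (f x)) ^+ 2)%:E < +oo)%E].

(* [cderive f] takes junk values where f is not differentiable, hence the     *)
(* clause on almost everywhere derivability, which is automatic for           *)
(* absolutely continuous f (Lebesgue).                                        *)
Definition W12 (R : realType) : set (R -> R[i]) :=
  [set f | [/\ abs_continuous01 f,
    {ae lebesgue_measure, forall x : R, x \in `[0, 1] -> cderivable f x} &
    square_integrable01 (cderive f)]].

Definition W12_inner (R : realType) (f g : R -> R[i]) : R[i] :=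
  cintegral01 (fun x => f x * conjc (g x) + cderive f x * conjc (cderive g x)).

Definition W12_norm (R : realType) (f : R -> R[i]) : R :=
  Num.sqrt (complex.Re (W12_inner f f)).

Definition W0 (R : realType) : set (R -> R[i]) :=
  [set f | [/\ W12 f, f 0 = 0 & f 1 = 0]].

Definition mult_op (R : realType) (phi f : R -> R[i]) : R -> R[i] :=
  fun x => if x \in `]0, 1[ then phi x * f x else 0.

Definition mult_dom (R : realType) (phi : R -> R[i]) : set (R -> R[i]) :=
  [set f | W0 f /\ W0 (mult_op phi f)].

Definition densely_defined_multiplier (R : realType) (phi : R -> R[i]) : Prop :=
  forall f, W0 f -> forall e : R, 0 < e ->
    exists2 g, mult_dom phi g & W12_norm (f \- g) < e.

(* Main.v *)
Require Import Defs.
From mathcomp Require Import all_boot all_order all_algebra.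
From mathcomp Require Import all_classical all_reals all_analysis.
From mathcomp Require Import measurable_realfun complex.
From mathcomp Require Import ring lra.

(** The derivative of a function of W_0 controls the function: increments are
at most the integral of |f'| (ac_increment_le_slope). Evaluation at a point of
(0, 1) is therefore continuous on W_0, and it is not identically zero, so it
cannot vanish on a dense subspace: for each x in (0, 1) some g in the domain of
multiplication by phi has g x <> 0 (mult_dom_nonvanishing). Near x, phi is the
quotient of phi g by g, two functions of W_0 of which the second is bounded away
from zero, and by compactness phi is absolutely continuous with square-integrable
derivative on every compact subinterval of (0, 1) (multiplier_sobolev).

All that can go wrong for phi is thus its behaviour at the endpoints. Instead of
a series of elements of the domain without common zero, take the single function
f = W / (1 + |phi|^2), where W > 0 on (0, 1) and W vanishes at 0 and 1. Both f
and phi f are products of W with a bounded Lipschitz function of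
(Re phi, Im phi), so their derivatives are at most a constant plus a multiple of
W |phi'|, and f, phi f are in W_0 as soon as W^2 |phi'|^2 is integrable
(weighted_sobolev). A weight W decreasing fast enough at the endpoints always
exists (exists_weight).

Complex functions are handled through their real and imaginary parts, and most of
the file concerns real functions g with the three properties of the predicate
sobolev a b g on an interval. *)

Set Implicit Arguments.
Unset Strict Implicit.
Unset Printing Implicit Defensive.
Import Order.TTheory GRing.Theory Num.Theory.
Import numFieldNormedType.Exports.
Local Open Scope classical_set_scope.
Local Open Scope ring_scope.

(** * Induction on intervals *)

Section cousin.
Context {R : realType}.

(** A property of intervals that is additive and holds on all short intervals
around each point holds on the whole interval: the supremum of the reachable
right endpoints is itself reachable, and can be passed unless it is b. This
replaces the choice of tagged partitions by an induction on intervals. *)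
Lemma cousin (P : R -> R -> Prop) (a b : R) : a <= b ->
  (forall s t r, a <= s -> s <= t -> t <= r -> r <= b ->
    P s t -> P t r -> P s r) ->
  (forall x, a <= x <= b -> exists2 d, 0 < d & forall s t,
     a <= s -> s <= x -> x <= t -> t <= b -> x - d < s -> t < x + d -> P s t) ->
  P a b.
Proof.
move=> ab Padd Ploc.
pose A := [set x | a <= x <= b /\ P a x].
have Aa : A a.
  split; first by rewrite lexx.
  have [|d d0 +] := Ploc a; first by rewrite lexx.
  by apply; rewrite ?lexx//; lra.
have ubA : ubound A b by move=> x [/andP[]].
have supA : has_sup A by split; [exists a|exists b].
pose c := sup A.
have ac : a <= c by apply: ub_le_sup => //; exists b.
have cb : c <= b by apply: ge_sup => //; exists a.
have [|d d0 Pc] := Ploc c; first by rewrite ac.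
have [y Ay cy] := sup_adherent d0 supA.
have yc : y <= c by apply: ub_le_sup => //; exists b.
have [/andP[ay yb] Pay] := Ay.
pose z := Num.min b (c + d / 2).
have zb : z <= b by rewrite /z ge_min lexx.
have cz : c <= z by rewrite /z le_min cb/=; lra.
have zd : z < c + d by rewrite /z gt_min; apply/orP; right; lra.
have Paz : P a z by apply: (Padd a y z) => //; [exact: le_trans cz|exact: Pc].
have zc : z <= c.
  by apply: ub_le_sup; [exists b|split => //; rewrite zb (le_trans ac)].
suff -> : b = z by [].
apply/eqP; rewrite eq_le zb andbT.
move: zc; rewrite {1}/z ge_min => /orP[bc|]; last lra.
exact: le_trans cz.
Qed.

End cousin.

(** * Borel measurability of derivatives *)

Section measurable_derive.
Context {R : realType}.

Definition diff_quotient (g : R -> R) (h x : R) := h^-1 * (g (h + x) - g x).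

Lemma diff_quotientE g h x : h^-1 *: ((g \o shift x) (h *: 1) - g x) = diff_quotient g h x.
Proof. by rewrite /diff_quotient /= /GRing.scale/= mulr1. Qed.

(** By completeness, differentiability is a Cauchy condition on difference
quotients; by continuity of g the increments may be restricted to the
rationals, so that the condition involves countable operations only. *)
Lemma derivable_cauchyP (g : R -> R) (x : R) : continuous g ->
  derivable g x 1 <->
  (forall n : nat, exists m : nat, forall r s : rat,
    0 < `|ratr r : R| < m.+1%:R^-1 -> 0 < `|ratr s : R| < m.+1%:R^-1 ->
    `|diff_quotient g (ratr r) x - diff_quotient g (ratr s) x| <= n.+1%:R^-1).
Proof.
move=> cg; split => [dg n|H].
- have /cvgrPdist_lt cv := dg.
  have e0 : 0 < n.+1%:R^-1 / 2 :> R by rewrite divr_gt0.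
  have := cv _ e0; set l := lim _ => -[/= d d0 Hd].
  have [m /= md] : exists m : nat, m.+1%:R^-1 < d.
    have := near_infty_natSinv_lt (PosNum d0) => -[m _ Hm].
    by exists m; apply: Hm => /=.
  exists m => r s /andP[r0 rm] /andP[s0 sm].
  have B k : 0 < `|ratr k : R| < m.+1%:R^-1 -> `|l - diff_quotient g (ratr k) x| < n.+1%:R^-1 / 2.
    move=> /andP[k0 km]; rewrite -diff_quotientE; apply: Hd; last by rewrite -normr_gt0.
    by rewrite /ball_/= sub0r normrN (lt_trans km).
  have := B r; have := B s; rewrite r0 rm s0 sm/= => /(_ isT) Bs /(_ isT) Br.
  rewrite -(subrKA l) (le_trans (ler_normD _ _))// [`|_ - l|]distrC.
  by rewrite (splitr n.+1%:R^-1) lerD// ltW.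
- apply: cauchy_cvg; apply/cauchy_ballP => e e0.
  have [n ne] : exists n : nat, n.+1%:R^-1 < e / 2.
    have e20 : 0 < e / 2 by rewrite divr_gt0.
    have := near_infty_natSinv_lt (PosNum e20) => -[m _ Hm].
    by exists m; apply: Hm => /=.
  have [m Hm] := H n.
  have m0 : 0 < m.+1%:R^-1 :> R by rewrite invr_gt0.
  (* A real increment is approximated by a rational one, by continuity. *)
  have approx (h eta : R) : 0 < eta -> 0 < `|h| < m.+1%:R^-1 ->
      exists2 r : rat, 0 < `|ratr r : R| < m.+1%:R^-1 &
        `|diff_quotient g h x - diff_quotient g (ratr r) x| < eta.
    move=> eta0 /andP[h0 hm].
    have cQ : {for h, continuous (diff_quotient g ^~ x)}.
      apply: cvgM; first by apply: cvgV => //; rewrite -normr_gt0.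
      apply: cvgB; last exact: cvg_cst.
      apply: (@continuous_comp _ _ _ (fun z => z + x) g); last exact: cg.
      by apply: cvgD; [exact: cvg_id|exact: cvg_cst].
    have /cvgrPdist_lt/(_ _ eta0) Hn := cQ.
    have n1 : \forall z \near h, 0 < `|z|.
      have := @norm_continuous _ R h => /cvgr_gt; apply; exact: h0.
    have n2 : \forall z \near h, `|z| < m.+1%:R^-1.
      have := @norm_continuous _ R h => /cvgr_lt; apply; exact: hm.
    have [d/= d0 Hd] : \forall z \near h,
        [/\ 0 < `|z|, `|z| < m.+1%:R^-1 & `|diff_quotient g h x - diff_quotient g z x| < eta].
      by near=> z; split; near: z.
    have [q] := @rat_in_itvoo R h (h + d) (ltac:(lra)).
    rewrite in_itv/= => /andP[hq qd].
    have [|q1 q2 q3] := Hd (ratr q); last by exists q => //; rewrite q1.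
    rewrite /ball/= distrC ger0_norm; lra.
  pose U := [set h : R | 0 < `|h| < m.+1%:R^-1].
  have nU : nbhs (0 : R)^' U.
    exists m.+1%:R^-1 => //= y; rewrite /ball/= sub0r normrN => ym y0.
    by rewrite /U/= normr_gt0 y0.
  pose V := [set y : R | exists2 h, U h & y = h^-1 *: ((g \o shift x) (h *: 1) - g x)].
  have nV : nbhs (h^-1 *: ((g \o shift x) (h *: 1) - g x) @[h --> 0^']) V.
    by apply: filterS nU => h Uh; exists h.
  exists (V, V) => //= -[y z] [/= [h Uh ->] [k Uk ->]].
  rewrite /ball/= (diff_quotientE g h x) (diff_quotientE g k x).
  have e40 : 0 < e / 4 by rewrite divr_gt0.
  have [r Ur hr] := approx h _ e40 Uh.
  have [s Us ks] := approx k _ e40 Uk.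
  have rs := Hm r s Ur Us.
  rewrite (_ : _ - _ = (diff_quotient g h x - diff_quotient g (ratr r) x) + (diff_quotient g (ratr r) x - diff_quotient g (ratr s) x)
    - (diff_quotient g k x - diff_quotient g (ratr s) x)); last lra.
  rewrite (le_lt_trans (ler_normB _ _))//.
  rewrite (le_lt_trans (lerD (ler_normD _ _) (lexx _)))//.
  have H3 (A B C n' : R) : A < e / 4 -> B <= n' -> C < e / 4 -> n' < e / 2 ->
    A + B + C < e by move=> *; lra.
  exact: (H3 _ _ _ _ hr rs ks ne).
Unshelve. all: by end_near. Qed.

Lemma measurable_diff_quotient (g : R -> R) (h : R) : continuous g ->
  measurable_fun setT (diff_quotient g h : measurableTypeR R -> measurableTypeR R).
Proof.
move=> cg; apply: measurable_funM => //; apply: measurable_funB.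
  apply: continuous_measurable_fun => x.
  apply: (@continuous_comp _ _ _ (fun z => h + z) g); last exact: cg.
  by apply: cvgD; [exact: cvg_cst|exact: cvg_id].
exact: continuous_measurable_fun.
Qed.

Lemma measurable_derivable (g : R -> R) : continuous g ->
  measurable [set x : measurableTypeR R | derivable g x 1].
Proof.
move=> cg.
have cQ h := measurable_diff_quotient h cg.
pose c m (r : rat) := 0 < `|ratr r : R| < m.+1%:R^-1.
pose A n m (rs : rat * rat) := [set x : R | c m rs.1 -> c m rs.2 ->
   `|diff_quotient g (ratr rs.1) x - diff_quotient g (ratr rs.2) x| <= n.+1%:R^-1].
have mA n m rs : measurable (A n m rs : set (measurableTypeR R)).
  rewrite /A; have [/andP[c1 c2]|nc] := boolP (c m rs.1 && c m rs.2); last first.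
    rewrite (_ : [set _ | _] = setT); first exact: measurableT.
    by apply/seteqP; split => // x _ /= c1 c2; rewrite c1 c2 in nc.
  rewrite (_ : [set _ | _] = setT `&` (fun x => `|diff_quotient g (ratr rs.1) x - diff_quotient g (ratr rs.2) x|)
      @^-1` `]-oo, n.+1%:R^-1]).
    have mf : measurable_fun setT (fun x : measurableTypeR R =>
        `|diff_quotient g (ratr rs.1) x - diff_quotient g (ratr rs.2) x|).
      by apply: measurableT_comp => //; apply: measurable_funB; exact: cQ.
    exact: mf.
  apply/seteqP; split => x /=; first by move=> /(_ c1 c2) H; rewrite in_itv/=.
  by move=> [_]; rewrite in_itv.
rewrite (_ : [set _ | _] = \bigcap_n \bigcup_m \bigcap_rs A n m rs); last first.
  apply/seteqP; split => x /=.
    move=> /derivable_cauchyP -/(_ cg) H n _; have [m Hm] := H n.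
    by exists m => // -[r s] _ /=; exact: Hm.
  move=> H; apply/derivable_cauchyP => // n; have [m _ Hm] := H n I.
  by exists m => r s; exact: (Hm (r, s) I).
apply: bigcapT_measurable => n; apply: bigcup_measurable => m _.
rewrite -[X in measurable X]setCK setC_bigcap; apply: measurableC.
apply: countable_bigcupT_measurable => //.
by move=> rs; apply: measurableC.
Qed.

(** Where g is not differentiable its derivative has a constant default
value, so it suffices that the set of differentiability is Borel; on that set
the derivative is a limit of continuous difference quotients. An argument up
to null sets would not do: measurability here means Borel measurability, and a
subset of a null Borel set need not be Borel. *)
Lemma measurable_derive1 (g : R -> R) : continuous g ->
  measurable_fun setT (derive1 g : measurableTypeR R -> measurableTypeR R).
Proof.
move=> cg; have mD := measurable_derivable cg.
set D := [set x | _] in mD.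
rewrite -(setUv D); apply/measurable_funU => //; first exact: measurableC.
split; last first.
  apply: (@eq_measurable_fun _ _ _ _ _ (cst point)); last exact: measurable_cst.
  by move=> x; rewrite inE => nD; rewrite derive1E; move: nD => /dvgP.
apply: (@measurable_fun_cvg _ _ _ _ (fun n x => diff_quotient g n.+1%:R^-1 x)).
  by move=> n; apply: measurable_funTS; exact: measurable_diff_quotient.
move=> x dg.
have := dg; rewrite /D/= /derivable.
set F := (fun h => _) => cF.
have -> : derive1 g x = lim (F h @[h --> 0^']).
  by rewrite derive1E.
rewrite (_ : (fun n => _) = (F \o (fun n : nat => n.+1%:R^-1))); last first.
  by apply/funext => n; rewrite /F -diff_quotientE.
apply: (@cvg_comp _ _ _ (fun n : nat => n.+1%:R^-1) F) cF.
move=> U [/= d d0 Hd]; have := near_infty_natSinv_lt (PosNum d0).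
apply: filterS => n /= nd; apply: Hd => //=.
by rewrite /ball/= sub0r normrN ger0_norm.
Qed.

End measurable_derive.

(** * Absolutely continuous and Sobolev functions on an interval *)

Section basics.
Context {R : realType}.
Implicit Types (a b : R) (g h : R -> R).
Notation mu := (@lebesgue_measure R).

Definition ac_on a b g : Prop := forall e : R, 0 < e -> exists2 d : R, 0 < d &
  forall (n : nat) (s t : 'I_n -> R),
    (forall i, a <= s i /\ s i <= t i /\ t i <= b) ->
    trivIset [set: 'I_n] (fun i => `]s i, t i[%classic) ->
    \sum_(i < n) (t i - s i) < d ->
    \sum_(i < n) `|g (t i) - g (s i)| < e.

Definition ae_derivable a b g : Prop :=
  {ae mu, forall x, x \in `]a, b[ -> derivable g x 1}.

Definition slope a b g : \bar R :=
  (\int[mu]_(x in `]a, b[) `|derive1 g x|%:E)%E.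

Definition energy a b g : \bar R :=
  (\int[mu]_(x in `]a, b[) ((derive1 g x) ^+ 2)%:E)%E.

Definition sobolev a b g : Prop :=
  [/\ ac_on a b g, ae_derivable a b g & (energy a b g < +oo)%E].

Lemma ac_unif a b g : ac_on a b g -> forall e, 0 < e -> exists2 d, 0 < d &
  forall s t, a <= s -> s <= t -> t <= b -> t - s < d -> `|g t - g s| < e.
Proof.
move=> acg e e0; have [d d0 H] := acg e e0; exists d => // s t as_ st tb std.
have := H 1%N (fun=> s) (fun=> t); rewrite !big_ord1; apply => //.
by move=> i j _ _ _; rewrite (ord1 i) (ord1 j).
Qed.

Lemma ac_sub a b s t g : a <= s -> t <= b -> ac_on a b g -> ac_on s t g.
Proof.
move=> as_ tb acg e e0; have [d d0 H] := acg e e0; exists d => // n p q pq.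
apply: H => i; have [h1 [h2 h3]] := pq i.
by rewrite (le_trans as_)// (le_trans h3).
Qed.

(** Constant extension outside [a, b], which makes results on functions
continuous on the whole line available for g. *)
Lemma ac_clamp_continuous a b g : a <= b -> ac_on a b g ->
  continuous (fun x => g (Num.max a (Num.min b x))).
Proof.
move=> ab /ac_unif acg x; apply/cvgrPdist_lt => e e0.
have [d d0 Hd] := acg e e0.
pose c (y : R) := Num.max a (Num.min b y).
have ca y : a <= c y by rewrite /c le_max lexx.
have cb y : c y <= b by rewrite /c ge_max ab ge_min lexx.
have cd y z : y <= z -> c y <= c z /\ c z - c y <= z - y.
  move=> yz; rewrite /c /Num.max /Num.min; do !case: ifPn; rewrite -?leNgt; lra.
exists d => //= y; rewrite /ball/= => xy.
have [yx|/ltW xy'] := leP y x.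
  have [h1 h2] := cd _ _ yx.
  by apply: (Hd (c y) (c x)) => //; rewrite (le_lt_trans h2)// (le_lt_trans _ xy)// ler_norm.
have [h1 h2] := cd _ _ xy'.
rewrite distrC in xy; rewrite distrC.
by apply: (Hd (c x) (c y)) => //; rewrite (le_lt_trans h2)// (le_lt_trans _ xy)// ler_norm.
Qed.

Lemma near_itvoo a b x : x \in `]a, b[ -> \forall y \near x, y \in `]a, b[.
Proof.
rewrite in_itv/= => /andP[ax xb].
exists (Num.min (x - a) (b - x)) => /=; first by rewrite lt_min !subr_gt0 ax.
move=> y /=; rewrite lt_min in_itv/= => /andP[].
rewrite !ltr_norml => /andP[? ?] /andP[? ?]; lra.
Qed.

Lemma ac_measurable_derive1 a b g : ac_on a b g ->
  measurable_fun `]a, b[ (derive1 g).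
Proof.
move=> acg; have [ab|ba] := ltP a b; last first.
  by rewrite set_itv_ge ?bnd_simp -?leNgt//; exact: measurable_fun_set0.
have cg := ac_clamp_continuous (ltW ab) acg.
set g' := (fun x => _) in cg.
apply: (@eq_measurable_fun _ _ _ _ _ (derive1 g')); last first.
  by apply: measurable_funTS; exact: measurable_derive1.
move=> x; rewrite inE/= => xab; rewrite !derive1E; apply: near_eq_derive.
apply: filterS (near_itvoo xab) => y; rewrite in_itv/= => /andP[ay yb].
by rewrite /g' min_r ?max_r// ltW.
Qed.

Lemma ae_mono (P Q : R -> Prop) : (forall x, P x -> Q x) ->
  {ae mu, forall x, P x} -> {ae mu, forall x, Q x}.
Proof. by move=> PQ; apply: filterS; first exact: (ae_filter_ringOfSetsType mu). Qed.

Lemma ae_and (P Q : R -> Prop) : {ae mu, forall x, P x} ->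
  {ae mu, forall x, Q x} -> {ae mu, forall x, P x /\ Q x}.
Proof. by apply: filterS2; first exact: (ae_filter_ringOfSetsType mu). Qed.

Lemma ae_neq (c : R) : {ae mu, forall x : R, x <> c}.
Proof.
rewrite /prop_near1 /almost_everywhere /=.
apply: (@negligibleS _ _ _ mu [set c]); first by move=> x /= /contrapT.
by apply/negligibleP => //; exact: lebesgue_measure_set1.
Qed.

Lemma ae_derivable_sub a b s t g : a <= s -> t <= b ->
  ae_derivable a b g -> ae_derivable s t g.
Proof.
move=> as_ tb; apply: ae_mono => x H xst; apply: H.
by move: xst; rewrite !in_itv/= => /andP[? ?]; rewrite (le_lt_trans as_)//= (lt_le_trans _ tb).
Qed.

Lemma measurable_derive1_sub a b s t g : a <= s -> t <= b ->
  measurable_fun `]a, b[ (derive1 g) -> measurable_fun `]s, t[ (derive1 g).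
Proof.
move=> as_ tb; apply: measurable_funS => //.
by apply: subset_itvW; rewrite ?bnd_simp.
Qed.

Lemma measurable_sqr_EFin (D : set R) (u : R -> R) : measurable_fun D u ->
  measurable_fun D (fun x => (u x ^+ 2)%:E).
Proof. by move=> mu_; apply/measurable_EFinP; exact: measurable_funX. Qed.

Lemma measurable_normr_EFin (D : set R) (u : R -> R) : measurable_fun D u ->
  measurable_fun D (fun x => `|u x|%:E).
Proof. by move=> mu_; apply/measurable_EFinP; apply: measurableT_comp. Qed.

Lemma energy_sub a b s t g : a <= s -> t <= b ->
  measurable_fun `]a, b[ (derive1 g) -> (energy s t g <= energy a b g)%E.
Proof.
move=> as_ tb mg; apply: ge0_subset_integral => //.
- exact: measurable_sqr_EFin.
- by move=> x _; rewrite lee_fin sqr_ge0.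
- by apply: subset_itvW; rewrite ?bnd_simp.
Qed.

Lemma sobolev_sub a b s t g : a <= s -> t <= b ->
  sobolev a b g -> sobolev s t g.
Proof.
move=> as_ tb [acg dg eg]; split.
- exact: ac_sub acg.
- exact: ae_derivable_sub dg.
- by apply: le_lt_trans eg; apply: energy_sub => //; exact: ac_measurable_derive1.
Qed.

(** A substitute for the Cauchy-Schwarz inequality, from the pointwise bound
|u| <= 1/eta + eta u^2; the choice of eta plays the role of optimisation. *)
Lemma integral_abs_le_sqr a b (u : R -> R) (eta : R) : a <= b -> 0 < eta ->
  measurable_fun `]a, b[ u ->
  (\int[mu]_(x in `]a, b[) `|u x|%:E <=
   (eta^-1 * (b - a))%:E + eta%:E * \int[mu]_(x in `]a, b[) (u x ^+ 2)%:E)%E.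
Proof.
move=> ab eta0 mfu.
have -> : (eta^-1 * (b - a))%:E = (\int[mu]_(x in `]a, b[) cst (eta^-1)%:E x)%E.
  rewrite integral_cst//= lebesgue_measure_itv/= lte_fin.
  by case: ltgtP ab => // -> _; rewrite subrr mulr0 mule0.
rewrite -ge0_integralZl//; last 3 first.
- exact: measurable_sqr_EFin.
- by move=> x _; rewrite lee_fin sqr_ge0.
- by rewrite lee_fin ltW.
rewrite -ge0_integralD//; last 3 first.
- by move=> x _; rewrite lee_fin invr_ge0 ltW.
- by move=> x _; rewrite -EFinM lee_fin mulr_ge0 ?sqr_ge0// ltW.
- by apply: measurable_funeM; exact: measurable_sqr_EFin.
apply: ge0_le_integral => //.
- exact: measurable_normr_EFin.
- apply: emeasurable_funD; first exact: measurable_cst.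
  by apply: measurable_funeM; exact: measurable_sqr_EFin.
move=> x _ /=; rewrite -EFinM -EFinD lee_fin -real_normK ?num_real//.
have [ux|ux] := leP `|u x| eta^-1.
  by rewrite (le_trans ux)// lerDl mulr_ge0 ?sqr_ge0// ltW.
rewrite (@le_trans _ _ (eta * `|u x| ^+ 2))//; last by rewrite lerDr invr_ge0 ltW.
rewrite expr2 mulrA ler_peMl//.
by rewrite -ler_pdivrMl// mulr1 ltW.
Qed.

Lemma sum_integral_le n (s t : 'I_n -> R) (A : set R) (f : R -> \bar R) :
  measurable A -> measurable_fun A f -> (forall x, A x -> 0 <= f x)%E ->
  trivIset [set: 'I_n] (fun i => `]s i, t i[%classic) ->
  (forall i, `]s i, t i[ `<=` A) ->
  (\sum_(i < n) \int[mu]_(x in `]s i, t i[) f x <= \int[mu]_(x in A) f x)%E.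
Proof.
move=> mA mf f0 tI sub.
have subU : \big[setU/set0]_(i <- index_enum 'I_n) `]s i, t i[%classic `<=` A.
  by rewrite -bigcup_seq => x [i _]; exact: sub.
have mU : measurable (\big[setU/set0]_(i <- index_enum 'I_n) `]s i, t i[%classic : set (measurableTypeR R)).
  exact: bigsetU_measurable.
rewrite -(@ge0_integral_bigsetU _ _ _ mu _ (fun i => `]s i, t i[%classic))//.
- exact: ge0_subset_integral.
- exact: index_enum_uniq.
- by apply: sub_trivIset tI.
- exact: measurable_funS mf.
- by move=> x /subU; exact: f0.
Qed.

(** Absolute continuity of the integral of a square-integrable function: in
integral_abs_le_sqr, a small eta controls the term with u^2 on any disjoint
family of intervals, after which a small total length controls the other. *)
Lemma ac_of_bound a b g (u : R -> R) : measurable_fun `]a, b[ u ->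
  (\int[mu]_(x in `]a, b[) (u x ^+ 2)%:E < +oo)%E ->
  (forall s t, a <= s -> s <= t -> t <= b ->
     (`|g t - g s|%:E <= \int[mu]_(x in `]s, t[) `|u x|%:E)%E) ->
  ac_on a b g.
Proof.
move=> mfu ufin Hg e e0.
set K := (\int[mu]_(x in `]a, b[) (u x ^+ 2)%:E)%E in ufin.
have K0 : (0 <= K)%E by apply: integral_ge0 => x _; rewrite lee_fin sqr_ge0.
have Kfin : K \is a fin_num by rewrite ge0_fin_numE.
pose k := fine K; have Kk : K = k%:E by rewrite fineK.
have k0 : 0 <= k by rewrite fine_ge0.
(* This eta makes eta * k at most e / 2; the length bound takes the other half. *)
pose eta := e / (2 * (k + 1)).
have eta0 : 0 < eta by rewrite divr_gt0// mulr_gt0// ltr_wpDl.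
exists (eta * (e / 2)); first by rewrite mulr_gt0// divr_gt0.
move=> n s t st tI sumd.
rewrite -lte_fin -sumEFin.
apply: (@le_lt_trans _ _ ((eta^-1 * \sum_(i < n) (t i - s i))%:E + eta%:E * K)%E).
  apply: (@le_trans _ _ (\sum_(i < n) ((eta^-1 * (t i - s i))%:E +
     eta%:E * \int[mu]_(x in `]s i, t i[) (u x ^+ 2)%:E))%E).
    apply: lee_sum => i _; have [h1 [h2 h3]] := st i.
    apply: (le_trans (Hg _ _ h1 h2 h3)); apply: integral_abs_le_sqr => //.
    apply: measurable_funS mfu => //.
    by apply: subset_itvW; rewrite ?bnd_simp.
  rewrite big_split/= sumEFin -mulr_sumr leeD2l//.
  rewrite -ge0_sume_distrr; last first.
    by move=> i _; apply: integral_ge0 => x _; rewrite lee_fin sqr_ge0.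
  rewrite lee_pmul2l// ?fin_numE//; apply: sum_integral_le => //.
  - exact: measurable_sqr_EFin.
  - by move=> x _; rewrite lee_fin sqr_ge0.
  - by move=> i; have [h1 [h2 h3]] := st i; apply: subset_itvW; rewrite ?bnd_simp.
rewrite Kk -EFinM -EFinD lte_fin.
have h1 : eta^-1 * \sum_(i < n) (t i - s i) < e / 2 by rewrite ltr_pdivrMl.
have h2 : eta * k <= e / 2.
  rewrite /eta mulrAC ler_pdivrMr ?mulr_gt0 ?ltr_wpDl//.
  rewrite mulrA divfK// ler_pM2l//; lra.
lra.
Qed.

End basics.

(** * The increment of an absolutely continuous function *)

Section chains.
Context {R : realType}.
Implicit Types (U : set R) (s t : R) (l : seq (R * R)).
Notation mu := (@lebesgue_measure R).

(** Lists of successive intervals inside U. Successive chains concatenate,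
which is what makes the property proved by cousin additive, and a chain is a
disjoint family to which absolute continuity applies. *)
Fixpoint chain U s l t : Prop :=
  if l is (p, q) :: l' then
    [/\ s <= p, p <= q, `]p, q[%classic `<=` U & chain U q l' t]
  else s <= t.

Definition increments (g : R -> R) l := \sum_(pq <- l) `|g pq.2 - g pq.1|.

Lemma chain_cat U s t r l l' : chain U s l t -> chain U t l' r ->
  chain U s (l ++ l') r.
Proof.
elim: l s => [|[p q] l ih] s /=; last by move=> [? ? ? ?] ?; split => //; exact: ih.
case: l' => [|[p q] l'] /=; first exact: le_trans.
by move=> st [tp pq pqU ?]; split => //; exact: le_trans tp.
Qed.

Lemma chain_le U s l t : chain U s l t -> s <= t.
Proof.
elim: l s => [|[p q] l ih] s //= [sp pq _ /ih qt].
by rewrite (le_trans sp)// (le_trans pq).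
Qed.

Lemma chain_nth U s l t : chain U s l t -> forall i, (i < size l)%N ->
  let pq := nth (0, 0) l i in
  [/\ s <= pq.1, pq.1 <= pq.2, pq.2 <= t & `]pq.1, pq.2[%classic `<=` U].
Proof.
elim: l s => [|[p q] l ih] s //= [sp pq pqU ql] [|i] /=.
  by move=> _; split => //; exact: chain_le ql.
rewrite ltnS => /(ih _ ql)[h1 h2 h3 h4]; split => //.
by rewrite (le_trans sp)// (le_trans pq).
Qed.

Lemma chain_nth_lt U s l t : chain U s l t -> forall i j, (i < j)%N ->
  (j < size l)%N -> (nth (0, 0) l i).2 <= (nth (0, 0) l j).1.
Proof.
elim: l s => [|[p q] l ih] s //= [sp pq pqU ql] [|i] [|j] //=.
  by rewrite ltnS => _ /(chain_nth ql)[].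
by rewrite !ltnS; exact: ih ql _ _.
Qed.

Lemma chain_increments_lt a b (g : R -> R) U (e d : R) :
  (forall (n : nat) (s t : 'I_n -> R),
    (forall i, a <= s i /\ s i <= t i /\ t i <= b) ->
    trivIset [set: 'I_n] (fun i => `]s i, t i[%classic) ->
    \sum_(i < n) (t i - s i) < d ->
    \sum_(i < n) `|g (t i) - g (s i)| < e) ->
  measurable (U : set (measurableTypeR R)) -> (mu U < d%:E)%E ->
  forall l, chain U a l b -> increments g l < e.
Proof.
move=> H mU Ud l cl; rewrite /increments (big_nth (0, 0)) big_mkord.
pose s (i : 'I_(size l)) := (nth (0, 0) l i).1.
pose t (i : 'I_(size l)) := (nth (0, 0) l i).2.
have cn (i : 'I_(size l)) := chain_nth cl (ltn_ord i).
have tI : trivIset [set: 'I_(size l)] (fun i => `]s i, t i[%classic).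
  have aux (i j : 'I_(size l)) x : (i < j)%N ->
      `]s i, t i[%classic x -> `]s j, t j[%classic x -> False.
    rewrite /s /t => ij /=; rewrite !in_itv/= => /andP[_ xt] /andP[sx _].
    have := chain_nth_lt cl ij (ltn_ord j) => le.
    by have := lt_trans (lt_le_trans xt le) sx; rewrite ltxx.
  move=> i j _ _ [x [xi xj]]; apply/val_inj => /=.
  by case: (ltngtP i j) => // ij; [have := aux _ _ _ ij xi xj|have := aux _ _ _ ij xj xi].
apply: (H _ s t) => //.
  by move=> i; have [] := cn i.
rewrite -lte_fin -sumEFin (le_lt_trans _ Ud)//.
rewrite -[mu U]mul1e -(integral_cst mu mU 1%E).
apply: (@le_trans _ _ (\sum_(i < size l) \int[mu]_(x in `]s i, t i[) cst 1%E x)%E).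
  apply: lee_sum => i _; have [_ st _ _] := cn i.
  rewrite integral_cst//= mul1e lebesgue_measure_itv/= lte_fin.
  by rewrite /s /t; case: ltgtP st => // -> _; rewrite subrr.
apply: sum_integral_le => //.
by move=> i; have [_ _ _ +] := cn i.
Qed.

End chains.

Section ftc.
Context {R : realType}.
Implicit Types (a b : R) (g : R -> R).
Notation mu := (@lebesgue_measure R).

Lemma derivable_increment g (x eta : R) : derivable g x 1 -> 0 < eta ->
  exists2 d, 0 < d & forall z, `|z - x| < d ->
    `|g z - g x| <= (`|derive1 g x| + eta) * `|z - x|.
Proof.
move=> dg eta0; have /cvgrPdist_lt/(_ _ eta0) := dg.
rewrite -/(derive g x 1) -derive1E => -[/= d d0 Hd]; exists d => // z zx.
have [->|nzx] := eqVneq z x; first by rewrite !subrr normr0 mulr0.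
have zx0 : z - x != 0 by rewrite subr_eq0.
have := Hd (z - x); rewrite /ball_/= sub0r normrN => /(_ zx zx0).
rewrite /GRing.scale/= mulr1 subrK => H.
rewrite -ler_pdivrMr ?normr_gt0// -normrV ?unitfE// -normrM mulrC.
rewrite -lerBlDl (le_trans (lerB_dist _ _))// distrC; exact: ltW.
Qed.

(** At a Lebesgue point of F, the mean of |F - F x| over a ball of radius
2 (z - y), which contains the interval, is less than eta / 4; hence |F x| (z - y)
exceeds the integral of |F| by little, uniformly over the intervals around x. *)
Lemma lebesgue_pt_increment (F : R -> R) (x eta : R) : measurable_fun setT F ->
  lebesgue_pt F x -> 0 < eta -> exists2 d, 0 < d & forall y z,
    y <= x -> x <= z -> x - d < y -> z < x + d ->
    ((`|F x| * (z - y))%:E <=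
     \int[mu]_(u in `]y, z[) `|F u|%:E + (eta * (z - y))%:E)%E.
Proof.
move=> mF lF eta0.
have e4 : (0 < eta / 4) by rewrite divr_gt0.
have /fine_cvgP[fin /cvgrPdist_lt/(_ _ e4) fin2] := lF.
have [/= d d0 Hd] : \forall r \near (0:R)^'+, (davg F x r < (eta / 4)%:E)%E.
  apply: filterS2 fin fin2 => r fr /=; rewrite sub0r normrN => h.
  by rewrite -(fineK fr) lte_fin (le_lt_trans (ler_norm _)).
exists (d / 4); first by rewrite divr_gt0.
move=> y z yx xz dy dz.
have [->|nyz] := eqVneq y z.
  by rewrite subrr !mulr0 adde0 integral_ge0// => u _; rewrite lee_fin.
have yz : y < z by rewrite lt_neqAle nyz (le_trans yx).
pose r := 2 * (z - y).
have r0 : 0 < r by rewrite mulr_gt0// subr_gt0.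
have := Hd r; rewrite /ball_/= sub0r normrN (ger0_norm (ltW r0)).
have -> : r < d by rewrite /r; lra.
move=> /(_ isT r0); rewrite /davg /iavg lebesgue_measure_ball ?(ltW r0)//.
rewrite inver mulrn_eq0/= gt_eqF//= lte_pdivrMl ?mulrn_wgt0//.
rewrite -EFinM (_ : r *+ 2 * (eta / 4) = eta * (z - y)); last first.
  by rewrite /r -mulr_natl; lra.
move=> /ltW Hr.
have -> : ((`|F x| * (z - y))%:E = \int[mu]_(u in `]y, z[) cst `|F x|%:E u)%E.
  by rewrite integral_cst//= lebesgue_measure_itv/= lte_fin yz -EFinD -EFinM.
have mFx D : measurable_fun D (fun u => `|F u - F x|%:E).
  apply: measurable_funTS; apply/measurable_EFinP; apply: measurableT_comp => //.
  exact: measurable_funB.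
have mFa D : measurable_fun D (fun u => `|F u|%:E).
  by apply: measurable_funTS; exact: measurable_normr_EFin.
apply: (@le_trans _ _ (\int[mu]_(u in `]y, z[) (`|F u|%:E + `|F u - F x|%:E))%E).
  apply: ge0_le_integral => //.
  - by move=> u _; rewrite lee_fin.
  - by apply: emeasurable_funD; [exact: mFa|exact: mFx].
  - by move=> u _; rewrite -EFinD lee_fin -{1}(subKr (F u) (F x)) ler_normB.
rewrite ge0_integralD//; last 2 first.
- exact: mFa.
- exact: mFx.
apply: leeD2l; apply: le_trans Hr.
apply: ge0_subset_integral => //; [exact: measurable_ball|exact: mFx|].
move=> u /=; rewrite in_itv/= /ball/= => /andP[yu uz].
by rewrite ltr_norml /r; apply/andP; split; lra.
Qed.

Lemma itvoo_setD1 a b c : a <= c -> c <= b ->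
  `]a, b[%classic `\ c = `]a, c[%classic `|` `]c, b[%classic.
Proof.
move=> ac cb; apply/seteqP; split => x /=; rewrite !in_itv/=.
  by move=> [/andP[ax xb] /eqP xc]; have [?|?|/eqP] := ltgtP x c;
    [left; rewrite ax|right|rewrite (negbTE xc)].
move=> [/andP[ax xc]|/andP[cx xb]].
  by rewrite ax (lt_le_trans xc)//=; split => // xE; rewrite xE ltxx in xc.
by rewrite xb (le_lt_trans ac)//=; split => // xE; rewrite xE ltxx in cx.
Qed.

Lemma integral_itvoo_split a b c (f : R -> \bar R) : a <= c -> c <= b ->
  measurable_fun `]a, b[ f -> (forall x, 0 <= f x)%E ->
  (\int[mu]_(x in `]a, b[) f x =
   \int[mu]_(x in `]a, c[) f x + \int[mu]_(x in `]c, b[) f x)%E.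
Proof.
move=> ac cb mf f0.
have mS : measurable (`]a, b[%classic `\ c : set (measurableTypeR R)).
  exact: measurableD.
rewrite -(@integral_setD1 _ _ c)//; last by apply: measurable_funS mf => // x [].
rewrite itvoo_setD1// ge0_integral_setU//.
- by rewrite -itvoo_setD1//; apply: measurable_funS mf => // x [].
- rewrite disj_set2E; apply/eqP/seteqP; split => // x /=.
  rewrite !in_itv/= => -[/andP[_ xc] /andP[cx _]].
  by have := lt_trans xc cx; rewrite ltxx.
Qed.

Lemma measurable_itvoo_glue d' (T : measurableType d') a b c (f : R -> T) :
  a <= c -> c <= b ->
  measurable_fun `]a, c[ f -> measurable_fun `]c, b[ f ->
  measurable_fun `]a, b[ f.
Proof.
move=> ac cb m1 m2.
have : measurable_fun ((`]a, b[%classic `\ c) `|` [set c]) f.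
  apply/measurable_funU => //; first exact: measurableD.
  split; last exact: measurable_fun_set1.
  by rewrite itvoo_setD1//; apply/measurable_funU.
apply: measurable_funS => //.
  by apply: measurableU => //; exact: measurableD.
by move=> x xab; have [->|xc] := eqVneq x c; [right|left; split => //; exact/eqP].
Qed.

Lemma slope_split a b c g : a <= c -> c <= b ->
  measurable_fun `]a, b[ (derive1 g) -> slope a b g = (slope a c g + slope c b g)%E.
Proof.
move=> ac cb mg; apply: integral_itvoo_split => //; exact: measurable_normr_EFin.
Qed.

Lemma energy_split a b c g : a <= c -> c <= b ->
  measurable_fun `]a, b[ (derive1 g) -> energy a b g = (energy a c g + energy c b g)%E.
Proof.
move=> ac cb mg; apply: integral_itvoo_split => //; first exact: measurable_sqr_EFin.
by move=> x; rewrite lee_fin sqr_ge0.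
Qed.

Lemma slope_ge0 a b g : (0 <= slope a b g)%E.
Proof. by apply: integral_ge0 => x _; rewrite lee_fin. Qed.

(** The half of the fundamental theorem of calculus that is used throughout.
Almost every x is a point of differentiability of g and a Lebesgue point of
|g'|, and there the bound holds up to eta (t - s) on short intervals around x.
The exceptional null set is covered by an open set U of small measure: short
intervals around its points are put in the chain, whose total contribution is
small by absolute continuity. The two kinds of intervals are assembled by
cousin. *)
Lemma ac_increment_le_slope a b g : a <= b -> ac_on a b g -> ae_derivable a b g ->
  (slope a b g < +oo)%E -> (`|g b - g a|%:E <= slope a b g)%E.
Proof.
move=> ab acg dg sfin; apply/lee_addgt0Pr => e e0.
have mg := ac_measurable_derive1 acg.
pose F := (fun x => `|derive1 g x|) \_ `]a, b[%classic.
have iF : mu.-integrable `]a, b[ (EFin \o (fun x => `|derive1 g x|)).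
  apply/integrableP; split; first exact: measurable_normr_EFin.
  by under eq_integral do rewrite /= normr_id.
have mF : measurable_fun setT F.
  by apply/(measurable_restrictT _ _).1 => //; exact: measurableT_comp.
have /lebesgue_differentiation lF :=
  integrable_locally_restrict (measurable_itv _) iF.
have [d d0 Hd] : exists2 d, 0 < d & forall U,
    measurable (U : set (measurableTypeR R)) -> (mu U < d%:E)%E ->
    forall l, chain U a l b -> increments g l < e / 2.
  have [d d0 H] := acg (e / 2) (ltac:(by rewrite divr_gt0)).
  by exists d => // U mU Ud l; exact: chain_increments_lt H mU Ud l.
pose good x := (x \in `]a, b[ -> derivable g x 1) /\ lebesgue_pt F x.
have neg : mu.-negligible ([set x | ~ good x] `|` [set a; b]).
  apply: negligibleU; first exact: ae_and dg lF.
  apply: negligibleU; apply/negligibleP => //; exact: lebesgue_measure_set1.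
have [U [oU NU mUd]] : exists U, [/\ open U,
    [set x | ~ good x] `|` [set a; b] `<=` U & (mu U < d%:E)%E].
  have [U [oU NU mU]] := outer_measure_open_le
    ([set x | ~ good x] `|` [set a; b]) (ltac:(by rewrite divr_gt0) : 0 < d / 2).
  exists U; split => //; apply: (le_lt_trans mU).
  have /negligible_outer_measure -> := neg.
  by rewrite add0e lte_fin; lra.
have mU : measurable (U : set (measurableTypeR R)) by exact: open_measurable.
(* One half of e is spent on the good points, the other half on the chain. *)
pose eta := e / (2 * (b - a + 1)).
have ba0 : 0 < b - a + 1 by rewrite ltr_wpDl// subr_ge0.
have eta0 : 0 < eta by rewrite divr_gt0// mulr_gt0.
pose P s t := exists l, chain U s l t /\
  (`|g t - g s|%:E <= slope s t g + (eta * (t - s))%:E + (increments g l)%:E)%E.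
suff [l [cl Pl]] : P a b.
  apply: (le_trans Pl); rewrite -addeA leeD2l// -EFinD lee_fin.
  have := Hd U mU mUd l cl.
  have : eta * (b - a) <= e / 2.
    rewrite /eta mulrAC ler_pdivrMr ?mulr_gt0// mulrA divfK// ler_pM2l//; lra.
  by lra.
apply: cousin => //.
  move=> s t r as_ st tr rb [l1 [c1 H1]] [l2 [c2 H2]].
  exists (l1 ++ l2); split; first exact: chain_cat c1 c2.
  rewrite (@slope_split _ _ t)//; last first.
    by apply: measurable_derive1_sub mg.
  rewrite /increments big_cat/= -/(increments g l1) -/(increments g l2).
  rewrite (_ : eta * (r - s) = eta * (t - s) + eta * (r - t)); last lra.
  rewrite !EFinD.
  apply: (@le_trans _ _ (`|g t - g s|%:E + `|g r - g t|%:E)%E).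
    rewrite -EFinD lee_fin (_ : g r - g s = (g t - g s) + (g r - g t)); last lra.
    exact: ler_normD.
  apply: (le_trans (leeD H1 H2)).
  by rewrite addeACA (addeACA (slope s t g)).
move=> x /andP[ax xb].
have [Ux|nUx] := pselect (U x).
  have /= [d' d'0 Hd'] : \forall y \near x, U y by exact: open_nbhs_nbhs.
  exists d' => // s t as_ sx xt tb ds td.
  exists [:: (s, t)]; split => /=.
    split => //; first exact: le_trans xt.
    move=> y /=; rewrite in_itv/= => /andP[sy yt]; apply: Hd'.
    by rewrite /ball/= ltr_norml; apply/andP; split; lra.
  rewrite /increments big_seq1/= leeDr// adde_ge0 ?slope_ge0// lee_fin.
  by rewrite mulr_ge0 ?(ltW eta0)// subr_ge0 (le_trans sx).
have /not_orP[/= /contrapT[dgx lFx] /not_orP[/= xa xb']] := contra_not (@NU x) nUx.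
have xab : x \in `]a, b[.
  by rewrite in_itv/= !lt_neqAle ax xb !andbT eq_sym; apply/andP; split; exact/eqP.
have eta2 : 0 < eta / 2 by rewrite divr_gt0.
have [d1 d10 H1] := derivable_increment (dgx xab) eta2.
have [d2 d20 H2] := lebesgue_pt_increment mF lFx eta2.
exists (Num.min d1 d2); first by rewrite lt_min d10.
move=> s t as_ sx xt tb sd td; exists [::]; split => /=; first exact: le_trans xt.
have md1 : Num.min d1 d2 <= d1 by rewrite ge_min lexx.
have md2 : Num.min d1 d2 <= d2 by rewrite ge_min lexx orbT.
rewrite /increments big_nil adde0.
have sd2 : x - d2 < s by apply: le_lt_trans sd; rewrite lerB.
have td2 : t < x + d2 by apply: (lt_le_trans td); rewrite lerD2l.
have := H2 s t sx xt sd2 td2.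
have -> : F x = `|derive1 g x| by rewrite /F patchE mem_set.
rewrite normr_id.
have -> : (\int[mu]_(u in `]s, t[) `|F u|%:E = slope s t g)%E.
  apply: eq_integral => u; rewrite inE/= in_itv/= => /andP[su ut].
  rewrite /F patchE mem_set ?normr_id//= in_itv/= (le_lt_trans as_)//=.
  exact: lt_le_trans tb.
move=> H; apply: (@le_trans _ _ ((`|derive1 g x| * (t - s))%:E + (eta / 2 * (t - s))%:E)%E).
  rewrite -EFinD lee_fin -mulrDl.
  rewrite (_ : g t - g s = (g t - g x) - (g s - g x)); last by ring.
  apply: (le_trans (ler_normB _ _)).
  have h1 := H1 t (ltac:(by rewrite ger0_norm ?subr_ge0//; lra)).
  have h2 := H1 s (ltac:(by rewrite ler0_norm ?subr_le0//; lra)).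
  apply: (le_trans (lerD h1 h2)).
  rewrite -mulrDr [`|t - x|]ger0_norm ?subr_ge0// [`|s - x|]ler0_norm ?subr_le0//.
  by rewrite (_ : t - x + - (s - x) = t - s)//; ring.
apply: (le_trans (leeD2r _ H)).
by rewrite -addeA -EFinD -mulrDl -splitr.
Qed.

End ftc.

(** * Gluing and algebra of Sobolev functions *)

Section sobolev_theory.
Context {R : realType}.
Implicit Types (a b : R) (g h : R -> R).
Notation mu := (@lebesgue_measure R).

Lemma slope_lty a b g : a <= b -> measurable_fun `]a, b[ (derive1 g) ->
  (energy a b g < +oo)%E -> (slope a b g < +oo)%E.
Proof.
move=> ab mg eg; have := integral_abs_le_sqr ab ltr01 mg.
by move=> /le_lt_trans; apply; rewrite mul1e lte_add_pinfty ?ltry.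
Qed.

Lemma sobolev_increment a b g s t : sobolev a b g ->
  a <= s -> s <= t -> t <= b -> (`|g t - g s|%:E <= slope s t g)%E.
Proof.
move=> sg as_ st tb; have [acg dg eg] := sobolev_sub as_ tb sg.
apply: ac_increment_le_slope => //.
by apply: slope_lty => //; exact: ac_measurable_derive1.
Qed.

(** The converse of ac_increment_le_slope. A bound of increments by slopes is
additive in the interval, unlike the definition of absolute continuity, hence
its use for gluing. *)
Lemma sobolev_of_slope a b g : ae_derivable a b g ->
  measurable_fun `]a, b[ (derive1 g) -> (energy a b g < +oo)%E ->
  (forall s t, a <= s -> s <= t -> t <= b -> (`|g t - g s|%:E <= slope s t g)%E) ->
  sobolev a b g.
Proof. by move=> dg mg eg H; split => //; exact: ac_of_bound mg eg H. Qed.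

Lemma sobolev_glue a b c g : a <= c -> c <= b ->
  sobolev a c g -> sobolev c b g -> sobolev a b g.
Proof.
move=> ac cb s1 s2.
have [ac1 d1 e1] := s1; have [ac2 d2 e2] := s2.
have mg : measurable_fun `]a, b[ (derive1 g).
  by apply: (measurable_itvoo_glue ac cb); exact: ac_measurable_derive1.
apply: sobolev_of_slope => //.
- apply: ae_mono (ae_and (ae_neq c) (ae_and d1 d2)) => x [xc [h1 h2]].
  rewrite in_itv/= => /andP[ax xb].
  have [xc'|xc'|//] := ltgtP x c; first by apply: h1; rewrite in_itv/= ax.
  by apply: h2; rewrite in_itv/= xc'.
- by rewrite (energy_split ac cb mg) lte_add_pinfty.
move=> s t as_ st tb.
have [tc|/ltW ct] := leP t c; first exact: (sobolev_increment s1).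
have [cs|/ltW sc] := leP c s; first exact: (sobolev_increment s2).
rewrite (slope_split sc ct); last exact: measurable_derive1_sub mg.
rewrite (le_trans _ (leeD (sobolev_increment s1 as_ sc (lexx _))
  (sobolev_increment s2 (lexx _) ct tb)))//.
rewrite -EFinD lee_fin (_ : g t - g s = (g c - g s) + (g t - g c)); last by ring.
exact: ler_normD.
Qed.

Lemma derive1_dominated h g1 g2 (M x : R) : derivable h x 1 ->
  derivable g1 x 1 -> derivable g2 x 1 ->
  (\forall y \near x, `|h y - h x| <= M * (`|g1 y - g1 x| + `|g2 y - g2 x|)) ->
  `|derive1 h x| <= M * (`|derive1 g1 x| + `|derive1 g2 x|).
Proof.
move=> dh d1 d2 dom; rewrite !derive1E.
pose q g k := k^-1 *: ((g \o shift x) (k *: 1) - g x).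
have qc g : derivable g x 1 -> `|q g k| @[k --> 0^'] --> `|'D_1 g x|.
  by move=> dg; apply: cvg_norm.
have cM : M * (`|q g1 k| + `|q g2 k|) @[k --> 0^'] -->
    M * (`|'D_1 g1 x| + `|'D_1 g2 x|).
  apply: cvgM; first exact: cvg_cst.
  by apply: cvgD; exact: qc.
apply: (ler_cvg_to (qc _ dh) cM).
have [/= d d0 Hd] := dom.
exists d => // k; rewrite /ball_/= sub0r normrN => kd k0.
have := Hd (k + x); rewrite /ball_/= opprD addrCA subrr addr0 normrN => /(_ kd) H.
have qE g : `|q g k| = `|k^-1| * `|g (k + x) - g x|.
  by rewrite /q/= /GRing.scale/= mulr1 normrM.
by rewrite !qE -mulrDr mulrCA ler_wpM2l.
Qed.

Lemma near_itvcc a b x : x \in `]a, b[ -> \forall y \near x, a <= y <= b.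
Proof.
move=> /near_itvoo; apply: filterS => y; rewrite in_itv/= => /andP[ay yb].
by rewrite !ltW.
Qed.

Lemma lty_scale (k : R) (x y : \bar R) : 0 <= k -> (x < +oo)%E -> (y < +oo)%E ->
  (k%:E * (x + y) < +oo)%E.
Proof.
by move=> k0 xfin yfin; apply: lte_mul_pinfty => //; exact: lte_add_pinfty.
Qed.

Lemma sqr_dominated (M x p q : R) : `|x| <= M * (`|p| + `|q|) ->
  `|x| ^+ 2 <= 2 * M ^+ 2 * (`|p| ^+ 2 + `|q| ^+ 2).
Proof.
move=> H; apply: (@le_trans _ _ ((M * (`|p| + `|q|)) ^+ 2)).
  by rewrite ler_sqr ?nnegrE ?(le_trans _ H).
rewrite exprMn (_ : 2 * M ^+ 2 * _ = M ^+ 2 * (2 * (`|p| ^+ 2 + `|q| ^+ 2)));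
  last by ring.
rewrite ler_wpM2l ?sqr_ge0//.
have := sqr_ge0 (`|p| - `|q|); rewrite !expr2; lra.
Qed.

(** The source of all the closure properties of Sobolev functions below: a
bound of the increments of h by those of g1 and g2 gives both its absolute
continuity and the bound of its derivative; only the almost everywhere
differentiability of h has to be checked separately. *)
Lemma sobolev_dominated a b h g1 g2 (M : R) : 0 <= M ->
  sobolev a b g1 -> sobolev a b g2 -> ae_derivable a b h ->
  (forall s t, a <= s <= b -> a <= t <= b ->
    `|h t - h s| <= M * (`|g1 t - g1 s| + `|g2 t - g2 s|)) ->
  sobolev a b h.
Proof.
move=> M0 [ac1 d1 e1] [ac2 d2 e2] dh dom.
have ach : ac_on a b h.
  move=> e e0; pose e' := e / (2 * (M + 1)).
  have M1 : 0 < M + 1 by rewrite ltr_wpDl.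
  have e'0 : 0 < e' by rewrite divr_gt0// mulr_gt0.
  have [r1 r10 H1] := ac1 e' e'0; have [r2 r20 H2] := ac2 e' e'0.
  exists (Num.min r1 r2); first by rewrite lt_min r10.
  move=> n s t st tI; rewrite lt_min => /andP[lt1 lt2].
  have := H1 n s t st tI lt1; have := H2 n s t st tI lt2.
  set S1 := \sum_(i < n) _; set S2 := \sum_(i < n) _ => lS1 lS2.
  apply: (@le_lt_trans _ _ (M * (S2 + S1))).
    rewrite /S1 /S2 -big_split/= mulr_sumr; apply: ler_sum => i _.
    have [h1 [h2 h3]] := st i; apply: dom; first by rewrite h1 (le_trans h2).
    by rewrite h3 (le_trans h1).
  apply: (@le_lt_trans _ _ (M * (e' + e'))).
    by rewrite ler_wpM2l// lerD// ltW.
  have : (M + 1) * (e' + e') = e by rewrite /e'; field; rewrite gt_eqF.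
  by rewrite mulrDl mul1r => <-; rewrite ltrDl addr_gt0.
split; [exact: ach|exact: dh|].
have m1 := ac_measurable_derive1 ac1; have m2 := ac_measurable_derive1 ac2.
have mh := ac_measurable_derive1 ach.
apply: (@le_lt_trans _ _ ((2 * M ^+ 2)%:E * (energy a b g1 + energy a b g2))%E); last first.
  by apply: lty_scale e1 e2; rewrite mulr_ge0// sqr_ge0.
rewrite -ge0_integralD//; last 4 first.
- by move=> x _; rewrite lee_fin sqr_ge0.
- exact: measurable_sqr_EFin.
- by move=> x _; rewrite lee_fin sqr_ge0.
- exact: measurable_sqr_EFin.
rewrite -ge0_integralZl//; last 3 first.
- by apply: emeasurable_funD; exact: measurable_sqr_EFin.
- by move=> x _; rewrite -EFinD lee_fin addr_ge0 ?sqr_ge0.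
- by rewrite lee_fin mulr_ge0 ?sqr_ge0.
apply: ae_ge0_le_integral => //.
- by move=> x _; rewrite lee_fin sqr_ge0.
- exact: measurable_sqr_EFin.
- move=> x _; rewrite -EFinD -EFinM lee_fin.
  by apply: mulr_ge0; [rewrite mulr_ge0// sqr_ge0|rewrite addr_ge0// sqr_ge0].
- by apply: measurable_funeM; apply: emeasurable_funD; exact: measurable_sqr_EFin.
apply: ae_mono (ae_and dh (ae_and d1 d2)) => x [xh [x1 x2]] xab.
rewrite -EFinD -EFinM lee_fin.
have xab' : x \in `]a, b[ by [].
have := @derive1_dominated h g1 g2 M x (xh xab') (x1 xab') (x2 xab').
have [axx xbb] : a <= x /\ x <= b.
  by move: xab'; rewrite in_itv/= => /andP[/ltW ? /ltW ?].
have nr : \forall y \near x, `|h y - h x| <= M * (`|g1 y - g1 x| + `|g2 y - g2 x|).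
  by apply: filterS (near_itvcc xab') => y ?; apply: dom => //; rewrite axx.
move=> /(_ nr) H.
rewrite -(real_normK (num_real (derive1 h x))).
rewrite -(real_normK (num_real (derive1 g1 x))) -(real_normK (num_real (derive1 g2 x))).
exact: sqr_dominated.
Qed.

Lemma sobolev_id a b : sobolev a b id.
Proof.
split.
- move=> e e0; exists e => // n s t st _ H; apply: le_lt_trans H.
  by apply: ler_sum => i _; have [_ [st' _]] := st i; rewrite ger0_norm ?subr_ge0.
- by apply: aeW => x _; exact: derivable_id.
- rewrite /energy; under eq_integral do rewrite derive1_id expr1n.
  by rewrite integral_cst//= mul1e lebesgue_measure_itv/=; case: ifP => // _; rewrite ltry.
Qed.

Lemma sobolev_lipschitz a b g (L : R) : 0 <= L -> ae_derivable a b g ->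
  (forall s t, a <= s <= b -> a <= t <= b -> `|g t - g s| <= L * `|t - s|) ->
  sobolev a b g.
Proof.
move=> L0 dg H; apply: (@sobolev_dominated _ _ _ id id L);
  [exact: L0|exact: sobolev_id|exact: sobolev_id|exact: dg|].
by move=> s t sab tab; rewrite (le_trans (H s t sab tab))// ler_wpM2l// lerDl.
Qed.

Lemma sobolev_ext a b g h : (forall x, a <= x <= b -> g x = h x) ->
  sobolev a b g -> sobolev a b h.
Proof.
move=> gh sg; have [_ dg _] := sg.
apply: (@sobolev_dominated _ _ _ g g 1); [exact: ler01|exact: sg|exact: sg| |].
  apply: ae_mono dg => x dx xab; apply: near_eq_derivable (dx xab).
  by apply: filterS (near_itvcc xab) => y; exact: gh.
by move=> s t sab tab; rewrite mul1r !gh// lerDl.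
Qed.

Lemma sobolev_bounded a b g : a <= b -> sobolev a b g ->
  exists2 K, 0 < K & forall x, a <= x <= b -> `|g x| <= K.
Proof.
move=> ab sg; have [acg _ eg] := sg.
have mg := ac_measurable_derive1 acg.
have sfin : slope a b g \is a fin_num by rewrite ge0_fin_numE ?slope_ge0// slope_lty.
exists (`|g a| + fine (slope a b g) + 1).
  by rewrite ltr_wpDl// addr_ge0// fine_ge0// slope_ge0.
move=> x /andP[ax xb]; have := sobolev_increment sg (lexx _) ax xb.
have sle : (slope a x g <= slope a b g)%E.
  by rewrite (slope_split ax xb mg) leeDl// slope_ge0.
move=> /le_trans/(_ sle); rewrite -(fineK sfin) lee_fin => H.
have := lerB_dist (g x) (g a); move: H.
by lra.
Qed.

Lemma sobolevD a b g h : sobolev a b g -> sobolev a b h ->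
  sobolev a b (fun x => g x + h x).
Proof.
move=> sg sh; have [_ dg _] := sg; have [_ dh _] := sh.
apply: (@sobolev_dominated _ _ _ g h 1); [exact: ler01|exact: sg|exact: sh| |].
  apply: ae_mono (ae_and dg dh) => x [dx hx] xab.
  by apply: derivableD; [exact: dx|exact: hx].
move=> s t _ _; rewrite mul1r.
by rewrite opprD addrACA ler_normD.
Qed.

Lemma sobolevM a b g h : a <= b -> sobolev a b g -> sobolev a b h ->
  sobolev a b (fun x => g x * h x).
Proof.
move=> ab sg sh; have [_ dg _] := sg; have [_ dh _] := sh.
have [K K0 HK] := sobolev_bounded ab sg.
have [K' K'0 HK'] := sobolev_bounded ab sh.
apply: (@sobolev_dominated _ _ _ g h (K + K')); [|exact: sg|exact: sh| |].
- by rewrite addr_ge0// ltW.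
- apply: ae_mono (ae_and dg dh) => x [dx hx] xab.
  by apply: derivableM; [exact: dx|exact: hx].
move=> s t sab tab.
rewrite (_ : _ - _ = (g t - g s) * h t + g s * (h t - h s)); last by ring.
rewrite (le_trans (ler_normD _ _))// !normrM mulrDr lerD//.
  by rewrite mulrC ler_wpM2r// (le_trans (HK' _ tab))// lerDr ltW.
by rewrite ler_wpM2r// (le_trans (HK _ sab))// lerDl ltW.
Qed.

Lemma sobolevV a b g (c : R) : 0 < c -> sobolev a b g ->
  (forall x, a <= x <= b -> c <= `|g x|) ->
  sobolev a b (fun x => (g x)^-1).
Proof.
move=> c0 sg gc; have [_ dg _] := sg.
have gx0 x : a <= x <= b -> g x != 0.
  by move=> xab; rewrite -normr_gt0 (lt_le_trans c0)// gc.
apply: (@sobolev_dominated _ _ _ g g (c ^- 2)); [|exact: sg|exact: sg| |].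
- by rewrite invr_ge0 sqr_ge0.
- apply: ae_mono dg => x dx xab.
  apply: derivableV; last exact: dx.
  by apply: gx0; move: xab; rewrite in_itv/= => /andP[/ltW -> /ltW ->].
move=> s t sab tab.
have := gx0 _ sab; have := gx0 _ tab => t0 s0.
rewrite (_ : _ - _ = - (g t - g s) / (g s * g t)); last by field; rewrite s0 t0.
rewrite normrM normrN normrV ?unitfE ?mulf_neq0// mulrC.
apply: ler_pM => //; last by rewrite lerDl.
rewrite lef_pV2 ?posrE ?exprn_gt0 ?normr_gt0 ?mulf_neq0//.
by rewrite normrM expr2 ler_pM ?gc// ltW.
Qed.

Lemma sobolevN a b g : sobolev a b g -> sobolev a b (fun x => - g x).
Proof.
move=> sg; have [_ dg _] := sg; apply: (@sobolev_dominated _ _ _ g g 1);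
    [exact: ler01|exact: sg|exact: sg| |].
  by apply: ae_mono dg => x dx xab; apply: derivableN; exact: dx.
by move=> s t _ _; rewrite mul1r -opprD normrN lerDl.
Qed.

End sobolev_theory.

(** * Multipliers are locally Sobolev *)

Section complex_sobolev.
Context {R : realType}.
Notation mu := (@lebesgue_measure R).
Notation normc := ComplexField.Normc.normc.
Notation ReF f := (fun x => complex.Re (f x)).
Notation ImF f := (fun x => complex.Im (f x)).

Lemma normc_sqr (z : R[i]) :
  normc z ^+ 2 = complex.Re z ^+ 2 + complex.Im z ^+ 2.
Proof. by case: z => x y /=; rewrite sqr_sqrtr// addr_ge0 ?sqr_ge0. Qed.

Lemma normc_nneg (z : R[i]) : 0 <= normc z.
Proof. by case: z => x y /=; exact: sqrtr_ge0. Qed.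

Lemma ler_Re_normc (z : R[i]) : `|complex.Re z| <= normc z.
Proof.
rewrite -ler_sqr ?nnegrE ?normc_nneg// normc_sqr real_normK ?num_real//.
by rewrite lerDl sqr_ge0.
Qed.

Lemma ler_Im_normc (z : R[i]) : `|complex.Im z| <= normc z.
Proof.
rewrite -ler_sqr ?nnegrE ?normc_nneg// normc_sqr real_normK ?num_real//.
by rewrite lerDr sqr_ge0.
Qed.

Lemma normc_ler_ReIm (z : R[i]) : normc z <= `|complex.Re z| + `|complex.Im z|.
Proof.
rewrite -ler_sqr ?nnegrE ?normc_nneg ?addr_ge0// normc_sqr sqrrD.
rewrite !real_normK ?num_real// addrAC lerDl.
by rewrite mulrn_wge0// mulr_ge0.
Qed.

Lemma ReB (z w : R[i]) : complex.Re (z - w) = complex.Re z - complex.Re w.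
Proof. by case: z; case: w. Qed.

Lemma ImB (z w : R[i]) : complex.Im (z - w) = complex.Im z - complex.Im w.
Proof. by case: z; case: w. Qed.

Lemma integral01_oo (f : R -> \bar R) : measurable_fun `]0 : R, 1 : R[ f ->
  (\int[mu]_(x in `[0%R, 1%R]) f x = \int[mu]_(x in `]0%R, 1%R[) f x)%E.
Proof. exact: integral_itv_bndoo. Qed.

Lemma measurable_normc_sqr (D : set R) (h : R -> R[i]) :
  measurable_fun D (ReF h) -> measurable_fun D (ImF h) ->
  measurable_fun D (fun x => (normc (h x) ^+ 2)%:E).
Proof.
move=> mRe mIm; under [X in measurable_fun _ X]eq_fun do rewrite normc_sqr.
apply/measurable_EFinP.
by apply: measurable_funD; apply: measurable_funX.
Qed.

Lemma sobolev_of_W12 (f : R -> R[i]) : W12 f ->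
  sobolev 0 1 (ReF f) /\ sobolev 0 1 (ImF f).
Proof.
move=> [acf df [mRe mIm finf]].
have sub01 (x : R) : x \in `]0, 1[ -> x \in `[0, 1].
  by rewrite !in_itv/= => /andP[/ltW -> /ltW ->].
have aux (c : R[i] -> R) : (forall z, `|c z| <= normc z) ->
    (forall z w, c (z - w) = c z - c w) ->
    ac_on 0 1 (fun x => c (f x)).
  move=> cn cB e e0; have [d d0 H] := acf e e0; exists d => // n s t st tI sumd.
  apply: le_lt_trans (H n s t st tI sumd).
  by apply: ler_sum => i _; rewrite -cB.
have mn : measurable_fun `]0 : R, 1 : R[ (fun x => (normc (cderive f x) ^+ 2)%:E).
  apply: measurable_normc_sqr; [move: mRe|move: mIm];
    by apply: measurable_funS => //; apply: subset_itvW; rewrite ?bnd_simp.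
have efin (g : R -> R) : ac_on 0 1 g ->
    (forall x, `|derive1 g x| <= normc (cderive f x)) -> (energy 0 1 g < +oo)%E.
  move=> acg gle; apply: le_lt_trans finf; rewrite integral01_oo//.
  apply: ge0_le_integral => //.
  - by move=> x _; rewrite lee_fin sqr_ge0.
  - by apply: measurable_sqr_EFin; exact: ac_measurable_derive1.
  - by move=> x _; rewrite lee_fin -real_normK ?num_real// ler_sqr ?nnegrE ?normc_nneg.
have acRe := aux _ ler_Re_normc ReB; have acIm := aux _ ler_Im_normc ImB.
split; split.
- exact: acRe.
- by apply: ae_mono df => x H /sub01 /H[h1 h2]; exact: h1.
- by apply: efin => // x; exact: (ler_Re_normc (cderive f x)).
- exact: acIm.
- by apply: ae_mono df => x H /sub01 /H[h1 h2]; exact: h2.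
- by apply: efin => // x; exact: (ler_Im_normc (cderive f x)).
Qed.

Lemma W12_of_sobolev (f : R -> R[i]) :
  sobolev 0 1 (ReF f) -> sobolev 0 1 (ImF f) -> W12 f.
Proof.
move=> [ac1 d1 e1] [ac2 d2 e2].
have m1 := ac_measurable_derive1 ac1; have m2 := ac_measurable_derive1 ac2.
split.
- move=> e e0; have e20 : 0 < e / 2 by rewrite divr_gt0.
  have [r1 r10 H1] := ac1 _ e20; have [r2 r20 H2] := ac2 _ e20.
  exists (Num.min r1 r2); first by rewrite lt_min r10.
  move=> n s t st tI; rewrite lt_min => /andP[lt1 lt2].
  have h1 := H1 n s t st tI lt1; have h2 := H2 n s t st tI lt2.
  apply: (@le_lt_trans _ _ (\sum_(i < n) (`|complex.Re (f (t i)) - complex.Re (f (s i))|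
     + `|complex.Im (f (t i)) - complex.Im (f (s i))|))).
    by apply: ler_sum => i _; rewrite -ReB -ImB; exact: normc_ler_ReIm.
  by rewrite big_split/= (splitr e) ltrD.
- apply: ae_mono (ae_and (ae_and (ae_neq 0) (ae_neq 1)) (ae_and d1 d2)).
  move=> x [[x0 x1] [h1 h2]]; rewrite in_itv/= => /andP[ge0 le1].
  have xin : x \in `]0, 1[.
    by rewrite in_itv/= !lt_neqAle ge0 le1 !andbT eq_sym; apply/andP; split; exact/eqP.
  by split; [exact: h1|exact: h2].
- split; [exact: measurable_fun_itv_cc m1|exact: measurable_fun_itv_cc m2|].
  have mE : measurable_fun `]0 : R, 1 : R[ (fun x => (normc (cderive f x) ^+ 2)%:E).
    exact: measurable_normc_sqr.
  rewrite integral01_oo//; under eq_integral do rewrite normc_sqr EFinD.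
  rewrite ge0_integralD//.
  + by apply: lte_add_pinfty; [exact: e1|exact: e2].
  + by move=> x _; rewrite lee_fin sqr_ge0.
  + exact: measurable_sqr_EFin.
  + by move=> x _; rewrite lee_fin sqr_ge0.
  + exact: measurable_sqr_EFin.
Qed.

Lemma ac_measurable a b (g : R -> R) : ac_on a b g -> measurable_fun `]a, b[ g.
Proof.
move=> acg; have [ab|ba] := ltP a b; last first.
  by rewrite set_itv_ge ?bnd_simp -?leNgt//; exact: measurable_fun_set0.
have cg := ac_clamp_continuous (ltW ab) acg.
apply: (@eq_measurable_fun _ _ _ _ _ (fun x => g (Num.max a (Num.min b x)))).
  move=> x; rewrite inE/= in_itv/= => /andP[ax xb].
  by rewrite min_r ?max_r// ltW.
by apply: measurable_funTS; exact: continuous_measurable_fun.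
Qed.

Lemma sobolev_sqr_integral a b (g : R -> R) : a <= b -> sobolev a b g ->
  (\int[mu]_(x in `]a, b[) (g x ^+ 2)%:E < +oo)%E.
Proof.
move=> ab sg; have [acg _ _] := sg.
have [K K0 HK] := sobolev_bounded ab sg.
apply: (@le_lt_trans _ _ (\int[mu]_(x in `]a, b[) cst (K ^+ 2)%:E x)%E).
  apply: ge0_le_integral => //.
  - by move=> x _; rewrite lee_fin sqr_ge0.
  - by apply: measurable_sqr_EFin; exact: ac_measurable.
  move=> x /=; rewrite in_itv/= => /andP[/ltW ax /ltW xb].
  by rewrite lee_fin -real_normK ?num_real// ler_sqr ?nnegrE ?(ltW K0)// HK ?ax.
rewrite integral_cst//= lebesgue_measure_itv/=.
by case: ifP => _; rewrite -?EFinD -?EFinM ?mule0 ltry.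
Qed.

Lemma energy_le_W12_norm (k : R -> R[i]) (e : R) : W12 k -> 0 < e ->
  W12_norm k < e -> (energy 0 1 (ReF k) <= (e ^+ 2)%:E)%E.
Proof.
move=> /sobolev_of_W12[s1 s2] e0.
have [ac1 _ e1] := s1; have [ac2 _ e2] := s2.
rewrite /W12_norm /W12_inner /cintegral01 /=.
pose H x := (complex.Re (k x) ^+ 2 + complex.Im (k x) ^+ 2) +
  (derive1 (ReF k) x ^+ 2 + derive1 (ImF k) x ^+ 2).
have -> : (fun x => complex.Re (k x * conjc (k x) + cderive k x * conjc (cderive k x))) = H.
  apply/funext => x; rewrite /H /cderive; case: (k x) => u v /=.
  by rewrite !mulrN !opprK !expr2.
have mk1 := ac_measurable ac1; have mk2 := ac_measurable ac2.
have mg1 := ac_measurable_derive1 ac1; have mg2 := ac_measurable_derive1 ac2.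
have mH : measurable_fun `]0 : R, 1 : R[ (fun x => (H x)%:E).
  apply/measurable_EFinP; apply: measurable_funD;
    by apply: measurable_funD; apply: measurable_funX.
have H0 x : 0 <= H x by rewrite /H !addr_ge0 ?sqr_ge0.
have sq0 (u : R -> R) : forall x, `]0, 1[%classic x -> (0 <= (u x ^+ 2)%:E)%E.
  by move=> x _; rewrite lee_fin sqr_ge0.
have finH : (\int[mu]_(x in `]0%R, 1%R[) (H x)%:E < +oo)%E.
  under eq_integral do rewrite /H !EFinD.
  have sqD0 (u v : R -> R) : forall x, `]0, 1[%classic x -> (0 <= (u x ^+ 2)%:E + (v x ^+ 2)%:E)%E.
    by move=> x _; rewrite -EFinD lee_fin addr_ge0 ?sqr_ge0.
  have msqD (u v : R -> R) : measurable_fun `]0 : R, 1 : R[ u -> measurable_fun `]0 : R, 1 : R[ v ->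
      measurable_fun `]0 : R, 1 : R[ (fun x => (u x ^+ 2)%:E + (v x ^+ 2)%:E)%E.
    by move=> mu' mv'; apply: emeasurable_funD; exact: measurable_sqr_EFin.
  rewrite ge0_integralD//; [|exact: sqD0|exact: msqD|exact: sqD0|exact: msqD].
  rewrite ge0_integralD//; [|exact: sq0|exact: measurable_sqr_EFin|exact: sq0|exact: measurable_sqr_EFin].
  rewrite ge0_integralD//; [|exact: sq0|exact: measurable_sqr_EFin|exact: sq0|exact: measurable_sqr_EFin].
  by apply: lte_add_pinfty; apply: lte_add_pinfty;
    [exact: (sobolev_sqr_integral ler01 s1)|exact: (sobolev_sqr_integral ler01 s2)|
     exact: e1|exact: e2].
rewrite /Rintegral integral01_oo//.
set I := (X in fine X) in finH *.
have I0 : (0 <= I)%E by apply: integral_ge0 => x _; rewrite lee_fin.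
have Ifin : I \is a fin_num by rewrite ge0_fin_numE.
move=> lte; apply: (@le_trans _ _ I).
  apply: ge0_le_integral => //.
  - by move=> x _; rewrite lee_fin sqr_ge0.
  - exact: measurable_sqr_EFin.
  move=> x _; rewrite lee_fin /H addrC -addrA lerDl.
  by rewrite !addr_ge0 ?sqr_ge0.
rewrite -(fineK Ifin) lee_fin leNgt; apply/negP => /ltW/ler_wsqrtr.
by rewrite sqrtr_sqr ger0_norm ?(ltW e0)// leNgt lte.
Qed.

Lemma sobolev_cst a b (c : R) : sobolev a b (fun=> c).
Proof.
apply: (@sobolev_lipschitz _ _ _ _ 0) => //.
  by apply: aeW => x _; exact: derivable_cst.
by move=> s t _ _; rewrite subrr normr0 mul0r.
Qed.

Lemma sobolevB a b (g h : R -> R) : sobolev a b g -> sobolev a b h ->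
  sobolev a b (fun x => g x - h x).
Proof. by move=> sg sh; apply: sobolevD; [exact: sg|exact: sobolevN]. Qed.

(** If every g in the domain vanished at x, then with f t = t (1 - t) all the
functions k = f - g would have Re (k x) - Re (k 0) = x (1 - x), whereas this
increment is at most the integral of |(Re k)'|, hence small with the norm of k.
With c = x (1 - x), norm at most c / 4 and eta = 4 / c, integral_abs_le_sqr
gives c <= c / 2. *)
Lemma mult_dom_nonvanishing (phi : R -> R[i]) : densely_defined_multiplier phi ->
  forall x, 0 < x < 1 -> exists2 g, mult_dom phi g & g x <> 0.
Proof.
move=> dphi x /andP[x0 x1]; apply: contrapT => noex.
have vanish g : mult_dom phi g -> g x = 0.
  by move=> Dg; apply: contrapT => gx; apply: noex; exists g.
pose f (t : R) : R[i] := Complex (t * (1 - t)) 0.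
have Wf : W0 f.
  split; [apply: W12_of_sobolev|by rewrite /f mul0r|by rewrite /f subrr mulr0].
  - apply: sobolevM; [exact: ler01|exact: sobolev_id|].
    by apply: sobolevB; [exact: sobolev_cst|exact: sobolev_id].
  - exact: sobolev_cst.
pose c := x * (1 - x).
have c0 : 0 < c by rewrite mulr_gt0// subr_gt0.
have e0 : 0 < c / 4 by rewrite divr_gt0.
have [g Dg fg] := dphi f Wf _ e0.
have gx := vanish g Dg.
have [[Wg g0 g1] _] := Dg.
have [Wf' f0 f1] := Wf.
have [sg1 sg2] := sobolev_of_W12 Wg; have [sf1 sf2] := sobolev_of_W12 Wf'.
have Wk : W12 (f \- g).
  apply: W12_of_sobolev.
  - apply: (@sobolev_ext _ _ _ (fun x => complex.Re (f x) - complex.Re (g x))).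
      by move=> y _; rewrite ReB.
    exact: sobolevB.
  - apply: (@sobolev_ext _ _ _ (fun x => complex.Im (f x) - complex.Im (g x))).
      by move=> y _; rewrite ImB.
    exact: sobolevB.
have Ek := energy_le_W12_norm Wk e0 fg.
have [sk _] := sobolev_of_W12 Wk; have [ack _ _] := sk.
have mk := ac_measurable_derive1 ack.
have := sobolev_increment sk (lexx _) (ltW x0) (ltW x1).
have -> : complex.Re ((f \- g) x) - complex.Re ((f \- g) 0) = c.
  rewrite -[(f \- g) x]/(f x - g x) -[(f \- g) 0]/(f 0 - g 0) f0 g0 gx !subr0.
  by [].
rewrite ger0_norm ?(ltW c0)// => H.
pose k1 := ReF (f \- g).
have : (c%:E <= slope 0 1 k1)%E.
  by apply: (le_trans H); rewrite (slope_split (ltW x0) (ltW x1) mk) leeDl// slope_ge0.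
have eta0 : 0 < 4 / c by rewrite divr_gt0.
move=> /le_trans/(_ (integral_abs_le_sqr ler01 eta0 mk)).
move=> /le_trans/(_ (leeD2l _ (lee_wpmul2l _ Ek))).
rewrite lee_fin (ltW eta0) => /(_ isT).
rewrite -EFinM -EFinD lee_fin.
rewrite (_ : _ + _ = c / 2); first by lra.
by field; rewrite gt_eqF.
Qed.

(** Near x, phi is the quotient of phi g by g, that is (phi g) conj(g) / |g|^2
with |g|^2 bounded below. *)
Lemma multiplier_locally_sobolev (phi : R -> R[i]) x g : 0 < x < 1 ->
  mult_dom phi g -> g x <> 0 ->
  exists2 d, 0 < d & forall s t, 0 < s -> s <= x -> x <= t -> t < 1 ->
    x - d < s -> t < x + d -> sobolev s t (ReF phi) /\ sobolev s t (ImF phi).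
Proof.
move=> /andP[x0 x1] [[Wg _ _] [Wpsi _ _]] gx.
have [sg1 sg2] := sobolev_of_W12 Wg; have [sp1 sp2] := sobolev_of_W12 Wpsi.
pose N y := complex.Re (g y) * complex.Re (g y) + complex.Im (g y) * complex.Im (g y).
have sN : sobolev 0 1 N.
  by apply: sobolevD; (apply: sobolevM; [exact: ler01| |]).
have Nx : 0 < N x.
  rewrite lt_neqAle addr_ge0 -?expr2 ?sqr_ge0// andbT eq_sym.
  apply: contra_notN gx; rewrite /N -!expr2 paddr_eq0 ?sqr_ge0//.
  by rewrite !sqrf_eq0; case: (g x) => u v /= /andP[/eqP -> /eqP ->].
have [acN _ _] := sN.
have [d d0 Hd] := ac_unif acN (ltac:(by rewrite divr_gt0) : 0 < N x / 2).
exists d; first exact: d0.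
move=> s t s0 sx xt t1 ds dt.
have Ny y : s <= y <= t -> N x / 2 <= N y.
  move=> /andP[sy yt]; have [yx|/ltW xy] := leP y x.
    have h : `|N x - N y| < N x / 2 by apply: Hd => //; lra.
    by have := ler_norm (N x - N y); lra.
  have h : `|N y - N x| < N x / 2 by apply: Hd => //; lra.
  by have := ler_norm (- (N y - N x)); rewrite normrN; lra.
have st := le_trans sx xt.
have sub u : sobolev 0 1 u -> sobolev s t u by apply: sobolev_sub; exact: ltW.
have sV : sobolev s t (fun y => (N y)^-1).
  apply: (@sobolevV _ _ _ _ (N x / 2)); [by rewrite divr_gt0|exact: sub|].
  by move=> y /Ny/le_trans; apply; exact: ler_norm.
have in01 y : s <= y <= t -> y \in `]0, 1[.
  by move=> /andP[sy yt]; rewrite in_itv/= (lt_le_trans s0)// (le_lt_trans yt).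
split.
- apply: (@sobolev_ext _ _ _ (fun y => (complex.Re (mult_op phi g y) * complex.Re (g y)
     + complex.Im (mult_op phi g y) * complex.Im (g y)) * (N y)^-1)).
    move=> y yst; have := Ny y yst; rewrite /mult_op in01// /N.
    case: (phi y) => p q; case: (g y) => u v /= H.
    have nz : u * u + v * v != 0 by rewrite gt_eqF// (lt_le_trans _ H)// divr_gt0.
    by field.
  apply: sobolevM; [exact: st| |exact: sV].
  by apply: sobolevD; (apply: sobolevM; [exact: st|exact: sub|exact: sub]).
- apply: (@sobolev_ext _ _ _ (fun y => (complex.Im (mult_op phi g y) * complex.Re (g y)
     - complex.Re (mult_op phi g y) * complex.Im (g y)) * (N y)^-1)).
    move=> y yst; have := Ny y yst; rewrite /mult_op in01// /N.
    case: (phi y) => p q; case: (g y) => u v /= H.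
    have nz : u * u + v * v != 0 by rewrite gt_eqF// (lt_le_trans _ H)// divr_gt0.
    by field.
  apply: sobolevM; [exact: st| |exact: sV].
  by apply: sobolevB; (apply: sobolevM; [exact: st|exact: sub|exact: sub]).
Qed.

(** Compactness of [a, b], in the form of cousin, and gluing. *)
Lemma multiplier_sobolev (phi : R -> R[i]) : densely_defined_multiplier phi ->
  forall a b, 0 < a -> a <= b -> b < 1 ->
    sobolev a b (ReF phi) /\ sobolev a b (ImF phi).
Proof.
move=> dphi a b a0 ab b1.
pose P s t := sobolev s t (ReF phi) /\ sobolev s t (ImF phi).
apply: (@cousin _ P _ _ ab).
  move=> s t r _ st tr _ [p1 p2] [q1 q2].
  by split; [exact: (sobolev_glue st tr p1 q1)|exact: (sobolev_glue st tr p2 q2)].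
move=> x /andP[ax xb].
have x01 : 0 < x < 1 by rewrite (lt_le_trans a0)//= (le_lt_trans xb).
have [g Dg gx] := mult_dom_nonvanishing dphi x01.
have [d d0 Hd] := multiplier_locally_sobolev x01 Dg gx.
exists d; first exact: d0.
move=> s t as_ sx xt tb ds dt.
exact: (Hd s t (lt_le_trans a0 as_) sx xt (le_lt_trans tb b1) ds dt).
Qed.

End complex_sobolev.

(** * Weights vanishing rapidly at the endpoints *)

Section weight.
Context {R : realType}.
Notation mu := (@lebesgue_measure R).

Definition increasing_from0 (q : R -> R) := [/\ {homo q : x y / x <= y},
  forall x, x <= 0 -> q x = 0 & forall x, 0 < x -> 0 < q x].

Definition primitive (q : R -> R) (x : R) := \int[mu]_(t in `]0, x]) q t.

Lemma ge0_of_from0 q x : increasing_from0 q -> 0 <= q x.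
Proof.
by move=> [_ q0 qp]; have [/q0 ->|/qp/ltW] := leP x 0.
Qed.

Lemma integrable_from0 q x y : increasing_from0 q ->
  mu.-integrable `]x, y] (EFin \o q).
Proof.
move=> iq; have [qh _ _] := iq; apply: measurable_bounded_integrable => //.
- by rewrite /= lebesgue_measure_itv/=; case: ifP => _; rewrite -?EFinD ltry.
- exact: nondecreasing_measurable.
exists (q y); split; first exact: num_real.
move=> M /ltW yM t /=; rewrite in_itv/= => /andP[_ ty].
by rewrite ger0_norm ?ge0_of_from0// (le_trans (qh _ _ ty)).
Qed.

Lemma primitive_increment q x y : increasing_from0 q -> x <= y ->
  0 <= primitive q y - primitive q x <= q y * (y - x).
Proof.
move=> iq xy; have [qh q0 qp] := iq.
have Pneg z : z <= 0 -> primitive q z = 0.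
  by move=> z0; rewrite /primitive set_itv_ge ?Rintegral_set0// bnd_simp -leNgt.
have main s t : 0 <= s -> s <= t ->
    0 <= primitive q t - primitive q s <= q t * (t - s).
  move=> s0 st; rewrite /primitive Rintegral_itvB ?bnd_simp//; last exact: integrable_from0.
  rewrite Rintegral_ge0/=; last by move=> u _; exact: ge0_of_from0.
  have -> : q t * (t - s) = \int[mu]_(u in `]s, t]) (q t).
    rewrite Rintegral_cst//= lebesgue_measure_itv/= lte_fin.
    by case: ltgtP st => //= -> _; rewrite subrr !mulr0.
  apply: le_Rintegral => //; first exact: integrable_from0.
    apply: measurable_bounded_integrable => //.
      by rewrite /= lebesgue_measure_itv/=; case: ifP => _; rewrite -?EFinD ltry.
    exists `|q t|; split; first exact: num_real.
    by move=> M /ltW tM u _.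
  by move=> u /=; rewrite in_itv/= => /andP[_]; exact: qh.
have [x0|/ltW x0] := leP 0 x; first exact: main.
rewrite (Pneg x)//.
have [y0|/ltW y0] := leP 0 y; last first.
  rewrite (Pneg y)// subrr lexx /=; apply: mulr_ge0; first exact: ge0_of_from0.
  by rewrite subr_ge0.
have := main 0 y (lexx _) y0; rewrite (Pneg 0)// => /andP[-> h] /=.
apply: (le_trans h); rewrite ler_wpM2l ?ge0_of_from0//; lra.
Qed.

Lemma primitive_from0 q : increasing_from0 q -> increasing_from0 (primitive q).
Proof.
move=> iq; have [qh q0 qp] := iq; split.
- by move=> x y xy; rewrite -subr_ge0; have /andP[] := primitive_increment iq xy.
- by move=> x x0; rewrite /primitive set_itv_ge ?Rintegral_set0// bnd_simp -leNgt.
move=> x x0; have x20 : 0 < x / 2 by rewrite divr_gt0.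
have x2x : x / 2 <= x by lra.
have /andP[h _] := primitive_increment iq (ltW x20).
have P0 : primitive q 0 = 0.
  by rewrite /primitive set_itv_ge ?Rintegral_set0// bnd_simp -leNgt.
rewrite P0 subr0 in h.
suff : q (x / 2) * (x / 2) <= primitive q x - primitive q (x / 2).
  have : 0 < q (x / 2) * (x / 2) by rewrite mulr_gt0// qp.
  by lra.
rewrite /primitive Rintegral_itvB ?bnd_simp ?(ltW x20)//; last exact: integrable_from0.
have -> : q (x / 2) * (x / 2) = \int[mu]_(u in `](x / 2), x]) (q (x / 2)).
  rewrite Rintegral_cst//= lebesgue_measure_itv/= lte_fin ifT; last by lra.
  by rewrite -EFinD /=; congr (_ * _); lra.
apply: le_Rintegral => //; last 2 first.
- exact: integrable_from0.
- by move=> u /=; rewrite in_itv/= => /andP[/ltW + _]; exact: qh.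
apply: measurable_bounded_integrable => //.
  by rewrite /= lebesgue_measure_itv/=; case: ifP => _; rewrite -?EFinD ltry.
exists `|q (x / 2)|; split; first exact: num_real.
by move=> M /ltW tM u _.
Qed.

Lemma primitive_continuous q : increasing_from0 q -> continuous (primitive q).
Proof.
move=> iq x; have [qh _ _] := iq.
have Q0 : 0 < q (`|x| + 1) + 1 by rewrite ltr_wpDl// ge0_of_from0.
apply/cvgrPdist_lt => e e0.
exists (Num.min 1 (e / (q (`|x| + 1) + 1))) => /=.
  by rewrite lt_min ltr01 divr_gt0.
move=> y /=; rewrite lt_min => /andP[xy1]; rewrite ltr_pdivlMr// => xye.
have xM : x <= `|x| + 1 by rewrite (le_trans (ler_norm _))// lerDl.
have yM : y <= `|x| + 1.
  have := ler_norm x; have := ler_norm (- (x - y)); rewrite normrN; lra.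
have aux s t : s <= t -> t <= `|x| + 1 ->
    `|primitive q t - primitive q s| <= `|t - s| * (q (`|x| + 1) + 1).
  move=> st tM; have /andP[h1 h2] := primitive_increment iq st.
  rewrite [`|t - s|]ger0_norm ?subr_ge0// [X in X <= _]ger0_norm//.
  rewrite (le_trans h2)// mulrC ler_wpM2l ?subr_ge0//.
  by have := qh _ _ tM; lra.
apply: le_lt_trans xye.
have [yx|/ltW xy] := leP y x; first exact: aux.
by rewrite distrC [`|x - y|]distrC; exact: aux.
Qed.

Lemma primitive_derivable q x : increasing_from0 q -> continuous q -> 0 < x ->
  derivable (primitive q) x 1.
Proof.
move=> iq cq x0.
have [] // := @continuous_FTC1 _ q (BRight 0) x (x + 1).
- by rewrite ltrDl.
- exact: integrable_from0.
- exact: cq.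
Qed.

(** Integrating twice turns an arbitrary nondecreasing q into a differentiable
w: the first primitive is continuous, and each primitive p of a nondecreasing
function r satisfies p x <= x * r x for x >= 0, which keeps w below q on [0, 1]. *)
Lemma exists_smooth_minorant (q : R -> R) : increasing_from0 q ->
  (forall x, q x <= 1) -> exists w : R -> R,
  [/\ increasing_from0 w, forall x, 0 < x -> derivable w x 1,
      forall x, 0 <= x -> x <= 1 -> w x <= x * q x &
      forall x y, 0 <= x -> x <= y -> y <= 1 -> w y - w x <= y - x].
Proof.
move=> iq q1.
have ip := primitive_from0 iq; have iw := primitive_from0 ip.
have [_ p0 _] := ip; have [_ w0 _] := iw.
have pb y : 0 <= y -> y <= 1 -> primitive q y <= y * q y.
  move=> y0 y1; have /andP[_] := primitive_increment iq y0.
  by rewrite (p0 0)// !subr0 mulrC.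
exists (primitive (primitive q)); split.
- exact: iw.
- by move=> x x0; apply: primitive_derivable => //; exact: primitive_continuous.
- move=> x x0 x1; have /andP[_] := primitive_increment ip x0.
  rewrite (w0 0)// !subr0 => /le_trans; apply; rewrite mulrC.
  rewrite ler_wpM2l// (le_trans (pb _ x0 x1))// ler_piMl// ge0_of_from0//.
move=> x y x0 xy y1; have /andP[_] := primitive_increment ip xy.
move=> /le_trans; apply; rewrite ler_piMl ?subr_ge0//.
have y0 := le_trans x0 xy.
by rewrite (le_trans (pb _ y0 y1))// mulr_ile1// ge0_of_from0.
Qed.

End weight.

Section exhaustion.
Context {R : realType}.
Notation mu := (@lebesgue_measure R).

(** The endpoint 2^-(n+1), so that the intervals ]cutoff n, 1 - cutoff n[
increase from the empty set to ]0, 1[ and the cutoffs are halved at each step. *)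
Definition cutoff (n : nat) : R := 2^-1 ^+ n.+1.

Lemma cutoffS n : cutoff n.+1 = cutoff n / 2.
Proof. by rewrite /cutoff exprSr. Qed.

Lemma cutoff_gt0 n : 0 < cutoff n.
Proof. by rewrite /cutoff exprn_gt0// invr_gt0. Qed.

Lemma cutoff_le n : cutoff n <= 2^-1.
Proof.
elim: n => [|n ih]; first by rewrite /cutoff expr1.
by rewrite cutoffS; have := cutoff_gt0 n; lra.
Qed.

Lemma exhaust01 (x : R) : 0 < x < 1 -> exists n, x \in `]cutoff n, 1 - cutoff n[.
Proof.
move=> /andP[x0 x1].
have m0 : 0 < Num.min x (1 - x) by rewrite lt_min x0 subr_gt0.
have [n _ /(_ n (leqnn n)) /= Hn] := near_infty_natSinv_lt (PosNum m0).
exists n; move: Hn; rewrite lt_min in_itv/= => /andP[h1 h2].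
suff h : cutoff n <= n.+1%:R^-1 by move: h h1 h2; set k := _^-1 => h h1 h2; apply/andP; split; lra.
rewrite /cutoff exprVn lef_pV2 ?posrE ?exprn_gt0//.
by rewrite -natrX ler_nat ltnW// ltn_expl.
Qed.

Lemma bigcup_exhaust01 :
  \bigcup_n `]cutoff n, 1 - cutoff n[%classic = `]0 : R, 1 : R[%classic.
Proof.
apply/seteqP; split => x /=.
  move=> [n _] /=; rewrite !in_itv/= => /andP[h1 h2].
  by have c0 := cutoff_gt0 n; apply/andP; split; lra.
by rewrite in_itv/= => /exhaust01[n xn]; exists n.
Qed.

Lemma ae_derivable_exhaust (g : R -> R) :
  (forall a b, 0 < a -> a <= b -> b < 1 -> ae_derivable a b g) ->
  ae_derivable 0 1 g.
Proof.
move=> H.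
have Hn n : ae_derivable (cutoff n) (1 - cutoff n) g.
  apply: H; [exact: cutoff_gt0| |].
  - by have := cutoff_le n; lra.
  - by have := cutoff_gt0 n; lra.
have := ae_foralln Hn; apply: ae_mono => x h.
by rewrite in_itv/= => /exhaust01[n]; exact: h.
Qed.

Lemma measurable_exhaust d (T : measurableType d) (f : R -> T) :
  (forall a b : R, 0 < a -> a <= b -> b < 1 -> measurable_fun `]a, b[ f) ->
  measurable_fun `]0 : R, 1 : R[ f.
Proof.
move=> H; rewrite -bigcup_exhaust01; apply/measurable_fun_bigcup => // n.
apply: H; [exact: cutoff_gt0| |].
- by have := cutoff_le n; lra.
- by have := cutoff_gt0 n; lra.
Qed.

Lemma integral_exhaust (f : R -> \bar R) (C : \bar R) :
  measurable_fun `]0 : R, 1 : R[ f -> (forall x, 0 <= f x)%E ->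
  (forall n, \int[mu]_(x in `]cutoff n, (1 - cutoff n)%R[) f x <= C)%E ->
  (\int[mu]_(x in `]0%R, 1%R[) f x <= C)%E.
Proof.
move=> mf f0 HC; rewrite -bigcup_exhaust01.
have cv : (\int[mu]_(x in `]cutoff n, (1 - cutoff n)%R[) f x)%E @[n --> \oo] -->
    (\int[mu]_(x in \bigcup_n `]cutoff n, (1 - cutoff n)%R[%classic) f x)%E.
  apply: ge0_nondecreasing_set_cvg_integral => //.
  - apply/nondecreasing_seqP => n; apply/subsetPset.
    by rewrite cutoffS; apply: subset_itvW; have c0 := cutoff_gt0 n; rewrite ?bnd_simp; lra.
  - move=> n; apply: measurable_funS mf => //.
    by rewrite -bigcup_exhaust01 => x xn; exists n.
rewrite -(cvg_lim _ cv)//.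
apply: lime_le; first by apply/cvg_ex; eexists; exact: cv.
exact: nearW.
Qed.

(** Let V a be the integral of v over ]a, 1 - a[. The weight is
W x = w x * w (1 - x), where w lies below x * q x with q x = 1 / (1 + V (x / 2)).
On the n-th shell between consecutive cutoffs a and a / 2, one has W <= a q a,
while the integral of v is at most V (a / 2): the shift by x / 2 in q makes the
contribution of the shell at most a^2 <= a - a / 2, and these bounds telescope. *)
Lemma exists_weight (v : R -> R) : (forall x, 0 <= v x) ->
  measurable_fun `]0 : R, 1 : R[ v ->
  (forall a, 0 < a -> (\int[mu]_(x in `]a, (1 - a)%R[) (v x)%:E < +oo)%E) ->
  exists W : R -> R,
    [/\ forall x, 0 < x < 1 -> 0 < W x,
        forall x, ~~ (0 < x < 1) -> W x = 0,
        forall x, 0 < x < 1 -> derivable W x 1,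
        forall s t, 0 <= s <= 1 -> 0 <= t <= 1 -> `|W t - W s| <= 2 * `|t - s| &
        (\int[mu]_(x in `]0%R, 1%R[) (W x ^+ 2 * v x)%:E < +oo)%E].
Proof.
move=> v0 mv vfin.
pose V a := fine (\int[mu]_(x in `]a, (1 - a)%R[) (v x)%:E)%E.
have mvs (a b : R) : 0 <= a -> b <= 1 -> measurable_fun `]a, b[ (fun x => (v x)%:E).
  move=> a0 b1; apply/measurable_EFinP; apply: measurable_funS mv => //.
  by apply: subset_itvW; rewrite ?bnd_simp.
have VE a : 0 < a -> (\int[mu]_(x in `]a, (1 - a)%R[) (v x)%:E = (V a)%:E)%E.
  move=> a0; rewrite fineK// ge0_fin_numE ?vfin//.
  by apply: integral_ge0 => x _; rewrite lee_fin.
have V0 a : 0 <= V a by apply: fine_ge0; apply: integral_ge0 => x _; rewrite lee_fin.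
have Vle a b : 0 < a -> a <= b -> V b <= V a.
  move=> a0 ab; rewrite -lee_fin -!VE//; last exact: lt_le_trans ab.
  apply: ge0_subset_integral => //; first by apply: mvs; [exact: ltW|lra].
  - by move=> x _; rewrite lee_fin.
  - by apply: subset_itvW; rewrite ?bnd_simp//; lra.
pose q x := if 0 < x then (1 + V (x / 2))^-1 else 0.
have Vp x : 0 < 1 + V (x / 2) by rewrite ltr_pwDl.
have q1 x : q x <= 1.
  rewrite /q; case: ifP => // _; rewrite invf_le1//.
  by rewrite lerDl.
have iq : increasing_from0 q.
  split.
  - move=> x y xy; rewrite /q; case: ifPn => [x0|_].
      rewrite (lt_le_trans x0 xy) lef_pV2 ?posrE// lerD2l Vle ?divr_gt0//.
      by rewrite ler_pM2r.
    by case: ifP => // _; rewrite invr_ge0 ltW.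
  - by move=> x x0; rewrite /q ltNge x0.
  - by move=> x x0; rewrite /q x0 invr_gt0.
have [w [iw dw wq wl]] := exists_smooth_minorant iq q1.
have [wh w0 wp] := iw.
have w00 : w 0 = 0 by apply: w0.
have wge x : 0 <= w x by have [/w0 ->|/wp/ltW] := leP x 0.
have wle1 x : x <= 1 -> w x <= 1.
  move=> x1; have [/w0 ->//|/ltW x0] := leP x 0.
  by have := wl 0 x (lexx _) x0 x1; rewrite w00; lra.
pose W x := w x * w (1 - x).
have W0 x : 0 <= W x by rewrite mulr_ge0.
exists W; split.
- by move=> x /andP[x0 x1]; rewrite mulr_gt0// wp// subr_gt0.
- move=> x; rewrite negb_and -!leNgt => /orP[x0|x1].
    by rewrite /W w0// mul0r.
  by rewrite /W [w (1 - x)]w0 ?mulr0// subr_le0.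
- move=> x /andP[x0 x1]; apply: derivableM; first exact: dw.
  have d1 : differentiable (fun t : R => 1 - t) x.
    apply/derivable1_diffP; apply: derivableB; first exact: derivable_cst.
    exact: derivable_id.
  have d2 : differentiable w (1 - x).
    by apply/derivable1_diffP; apply: dw; rewrite subr_gt0.
  by apply/derivable1_diffP; exact: (differentiable_comp d1 d2).
- have wlip s t : 0 <= s <= 1 -> 0 <= t <= 1 -> `|w t - w s| <= `|t - s|.
    move=> /andP[s0 s1] /andP[t0 t1].
    have [st|/ltW ts] := leP s t.
      by rewrite !ger0_norm ?subr_ge0 ?wh//; exact: wl.
    by rewrite distrC [`|t - s|]distrC !ger0_norm ?subr_ge0 ?wh//; exact: wl.
  move=> s t s01 t01; have /andP[s0 s1] := s01; have /andP[t0 t1] := t01.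
  rewrite /W (_ : _ - _ = (w t - w s) * w (1 - t) + w s * (w (1 - t) - w (1 - s))); last by ring.
  rewrite (le_trans (ler_normD _ _))// !normrM mulr_natl mulr2n lerD//.
    rewrite -[leRHS]mulr1 ler_pM ?wlip// ger0_norm// wle1//; lra.
  rewrite -[leRHS]mul1r ler_pM// ?(ger0_norm (wge _)) ?wle1//.
  have -> : `|t - s| = `|(1 - t) - (1 - s)| by rewrite distrC; congr `|_|; ring.
  by apply: wlip; apply/andP; split; lra.
have Wle a x : 0 < a -> a <= 1 -> 0 < x < 1 -> (x <= a) || (1 - a <= x) -> W x <= a * q a.
  move=> a0 a1 /andP[x0 x1] ha; apply: le_trans (wq _ (ltW a0) a1).
  move: ha => /orP[xa|ax].
    rewrite (le_trans _ (wh _ _ xa))// ler_piMr// wle1//; lra.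
  have xa : 1 - x <= a by lra.
  by rewrite (le_trans _ (wh _ _ xa))// ler_piMl// wle1// ltW.
have mW : measurable_fun setT W.
  apply: measurable_funM; first exact: nondecreasing_measurable.
  by apply: nonincreasing_measurable => // x y xy; apply: wh; lra.
have mWv : measurable_fun `]0 : R, 1 : R[ (fun x => (W x ^+ 2 * v x)%:E).
  apply/measurable_EFinP; apply: measurable_funM => //; apply: measurable_funX.
  exact: measurable_funTS.
have Wv0 x : (0 <= (W x ^+ 2 * v x)%:E)%E by rewrite lee_fin mulr_ge0 ?sqr_ge0.
apply: (@le_lt_trans _ _ (2^-1)%:E); last exact: ltry.
apply: integral_exhaust => // n.
apply: (@le_trans _ _ (2^-1 - cutoff n)%:E); last first.
  by rewrite lee_fin; have := cutoff_gt0 n; lra.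
elim: n => [|n ih].
  rewrite /cutoff expr1 set_itv_ge ?integral_set0 ?lee_fin ?subrr//.
  by rewrite bnd_simp -leNgt; lra.
have a0 := cutoff_gt0 n; have a'0 := cutoff_gt0 n.+1.
have aS := cutoffS n; have ale := cutoff_le n.
set A := `]cutoff n, (1 - cutoff n)%R[%classic in ih.
set B := `]cutoff n.+1, (1 - cutoff n.+1)%R[%classic.
have AB : A `<=` B by apply: subset_itvW; rewrite ?bnd_simp; lra.
have B01 : B `<=` `]0 : R, 1 : R[%classic by rewrite -bigcup_exhaust01 => x xn; exists n.+1.
have mA : measurable (A : set (measurableTypeR R)) by exact: measurable_itv.
have mB : measurable (B : set (measurableTypeR R)) by exact: measurable_itv.
have mBA : measurable (B `\` A : set (measurableTypeR R)) by exact: measurableD.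
have mfB : measurable_fun B (fun x => (W x ^+ 2 * v x)%:E) by exact: measurable_funS mWv.
have mvB : measurable_fun B (fun x => (v x)%:E) by apply: mvs; lra.
rewrite -(setDUK AB) ge0_integral_setU//; last 2 first.
- by rewrite setDUK.
- by rewrite disj_set2E setDIK.
pose c := (cutoff n * q (cutoff n)) ^+ 2.
have c0 : 0 <= c by exact: sqr_ge0.
apply: (@le_trans _ _ ((2^-1 - cutoff n)%:E + c%:E * (V (cutoff n.+1))%:E)%E).
  apply: leeD => //; rewrite -VE//.
  apply: (@le_trans _ _ (\int[mu]_(x in B `\` A) (c%:E * (v x)%:E))%E).
    apply: ge0_le_integral => //.
    - by apply: measurable_funS mfB => // x [].
    - by apply: measurable_funeM; apply: measurable_funS mvB => // x [].
    move=> x [Bx nAx]; rewrite -EFinM lee_fin ler_wpM2r// ler_sqr ?nnegrE//; last first.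
      by rewrite mulr_ge0 ?(ltW a0)// /q a0 invr_ge0 ltW.
    have x01 := B01 _ Bx; apply: Wle => //; first by lra.
    move: nAx => /negP; rewrite /A /= in_itv/= negb_and -!leNgt//.
  have mvBA : measurable_fun (B `\` A) (fun x => (v x)%:E).
    by apply: measurable_funS mvB => // x [].
  rewrite ge0_integralZl; [|exact: mBA|exact: mvBA| |by rewrite lee_fin]; last first.
    by move=> x _; rewrite lee_fin.
  apply: lee_wpmul2l; first by rewrite lee_fin.
  apply: ge0_subset_integral => //.
  by move=> x _; rewrite lee_fin.
rewrite -EFinM -EFinD lee_fin.
have : c * V (cutoff n.+1) <= cutoff n ^+ 2.
  rewrite /c exprMn -mulrA ler_piMr ?sqr_ge0//.
  rewrite /q a0 -aS; set X := V _.
  have X0 : 0 <= X by exact: V0.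
  have X1 : 0 < 1 + X by rewrite ltr_pwDl.
  rewrite exprVn mulrC ler_pdivrMr ?exprn_gt0// mul1r expr2; nra.
have : cutoff n ^+ 2 <= cutoff n / 2.
  by rewrite expr2 ler_wpM2l// ltW.
lra.
Qed.

End exhaustion.

(** * Weighted bounded functions of the multiplier *)

Section weighted.
Context {R : realType}.
Notation mu := (@lebesgue_measure R).
Notation ReF f := (fun x => complex.Re (f x)).
Notation ImF f := (fun x => complex.Im (f x)).

Lemma ae_derivable_sub01 (a b : R) (g : R -> R) : 0 < a -> b < 1 ->
  (forall x, 0 < x < 1 -> derivable g x 1) -> ae_derivable a b g.
Proof.
move=> a0 b1 H; apply: aeW => x; rewrite in_itv/= => /andP[ax xb].
by apply: H; rewrite (lt_trans a0)//= (lt_trans xb).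
Qed.

Lemma integral_affine_lty (a b c d : R) (f : R -> R) :
  0 <= c -> 0 <= d -> measurable_fun `]a, b[ f -> (forall x, 0 <= f x) ->
  (\int[mu]_(x in `]a, b[) (f x)%:E < +oo)%E ->
  (\int[mu]_(x in `]a, b[) (c + d * f x)%:E < +oo)%E.
Proof.
move=> c0 d0 mf f0 ffin.
have mfE : measurable_fun `]a, b[ (fun x => (f x)%:E) by exact/measurable_EFinP.
have f0E : forall x, `]a, b[%classic x -> (0 <= (f x)%:E)%E.
  by move=> x _; rewrite lee_fin.
have dE : (0 <= d%:E)%E by rewrite lee_fin.
under eq_integral do rewrite EFinD EFinM.
rewrite ge0_integralD; [|exact: measurable_itv| |exact: measurable_cst| |].
- rewrite ge0_integralZl; [|exact: measurable_itv|exact: mfE|exact: f0E|exact: dE].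
  apply: lte_add_pinfty; last exact: lte_mul_pinfty.
  rewrite integral_cst//= lebesgue_measure_itv/=.
  by case: ifP => _; rewrite -?EFinD -?EFinM ?mule0 ltry.
- by move=> x _; rewrite lee_fin.
- by move=> x _; rewrite -EFinM lee_fin mulr_ge0.
- exact: measurable_funeM.
Qed.

(** The product rule with |W'| <= 2, |B| <= 1 and |B'| <= C (|p1'| + |p2'|), the
bounds of derivatives coming from those of increments. *)
Lemma derivative_weighted (W B p1 p2 : R -> R) (C x : R) : 0 < x < 1 ->
  (forall s t, 0 <= s <= 1 -> 0 <= t <= 1 -> `|W t - W s| <= 2 * `|t - s|) ->
  (forall x, `|B x| <= 1) ->
  (forall s t, `|B t - B s| <= C * (`|p1 t - p1 s| + `|p2 t - p2 s|)) ->
  derivable W x 1 -> derivable B x 1 -> derivable p1 x 1 -> derivable p2 x 1 ->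
  derive1 (fun t => W t * B t) x ^+ 2 <= 8 +
    4 * C ^+ 2 * (W x ^+ 2 * (derive1 p1 x ^+ 2 + derive1 p2 x ^+ 2)).
Proof.
move=> x01 Wlip B1 Bdom dW dB d1 d2.
have hB : `|derive1 B x| <= C * (`|derive1 p1 x| + `|derive1 p2 x|).
  by apply: (derive1_dominated dB d1 d2); exists 1 => //= y _; exact: Bdom.
have hW : `|derive1 W x| <= 2.
  have := @derive1_dominated R W id id 1 x dW (@derivable_id _ _ x 1)
    (@derivable_id _ _ x 1).
  rewrite derive1_id normr1 mul1r => H; apply: H.
  have xin : x \in `]0, 1[ by rewrite in_itv.
  apply: filterS (near_itvcc xin) => y y01.
  rewrite mul1r -mulr2n -[leRHS]mulr_natl; apply: Wlip => //.
  by have /andP[/ltW -> /ltW ->] := x01.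
rewrite !derive1E in hB hW *.
rewrite (_ : (fun t => W t * B t) = W * B); last by apply/funext.
rewrite (deriveM dW dB) /GRing.scale/=.
set w' := 'D_1 W x in hW *; set b' := 'D_1 B x in hB *.
set u := 'D_1 p1 x in hB *; set v := 'D_1 p2 x in hB *.
have hb := sqr_dominated hB; rewrite !real_normK ?num_real// in hb.
have hw : w' ^+ 2 <= 4.
  have -> : (4 : R) = 2 ^+ 2 by rewrite -natrX.
  by rewrite -(real_normK (num_real w')) ler_sqr ?nnegrE.
have hBx : B x ^+ 2 <= 1.
  by rewrite -(real_normK (num_real (B x))) expr_le1.
apply: (@le_trans _ _ (2 * (B x ^+ 2 * w' ^+ 2) + 2 * (W x ^+ 2 * b' ^+ 2))).
  have := sqr_ge0 (W x * b' - B x * w').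
  by rewrite -!exprMn !expr2 => ?; lra.
apply: lerD.
  have -> : (8 : R) = 2 * (1 * 4) by rewrite mul1r -natrM.
  by rewrite ler_wpM2l// ler_pM ?sqr_ge0.
rewrite (_ : 4 * C ^+ 2 * _ = 2 * (W x ^+ 2 * (2 * C ^+ 2 * (u ^+ 2 + v ^+ 2)))); last by ring.
by rewrite ler_wpM2l// ler_wpM2l ?sqr_ge0.
Qed.

(** On compact subintervals of ]0, 1[ this is the product of Sobolev
functions, and derivative_weighted makes the derivative h' square-integrable
up to the endpoints. The increments from or to an endpoint are bounded by
those of W, so 2 + |h'| bounds all increments on [0, 1]. *)
Lemma weighted_sobolev (W B p1 p2 : R -> R) (C : R) : 0 <= C ->
  (forall a b, 0 < a -> a <= b -> b < 1 -> sobolev a b p1 /\ sobolev a b p2) ->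
  (forall x, ~~ (0 < x < 1) -> W x = 0) ->
  (forall x, 0 < x < 1 -> derivable W x 1) ->
  (forall s t, 0 <= s <= 1 -> 0 <= t <= 1 -> `|W t - W s| <= 2 * `|t - s|) ->
  (\int[mu]_(x in `]0%R, 1%R[)
     (W x ^+ 2 * (derive1 p1 x ^+ 2 + derive1 p2 x ^+ 2))%:E < +oo)%E ->
  (forall x, `|B x| <= 1) ->
  (forall s t, `|B t - B s| <= C * (`|p1 t - p1 s| + `|p2 t - p2 s|)) ->
  (forall x, derivable p1 x 1 -> derivable p2 x 1 -> derivable B x 1) ->
  sobolev 0 1 (fun x => W x * B x).
Proof.
move=> C0 sp W0 dW Wlip Wfin B1 Bdom dB.
pose h x := W x * B x.
have aeB (a b : R) : 0 < a -> a <= b -> b < 1 -> ae_derivable a b B.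
  move=> a0 ab b1; have [[_ d1 _] [_ d2 _]] := sp a b a0 ab b1.
  apply: ae_mono (ae_and d1 d2) => x [h1 h2] xab.
  by apply: dB; [exact: h1|exact: h2].
have aep : ae_derivable 0 1 p1 /\ ae_derivable 0 1 p2.
  by split; apply: ae_derivable_exhaust => a b a0 ab b1;
    have [[_ d1 _] [_ d2 _]] := sp a b a0 ab b1.
have mp : measurable_fun `]0 : R, 1 : R[ (derive1 p1) /\
    measurable_fun `]0 : R, 1 : R[ (derive1 p2).
  by split; apply: measurable_exhaust => a b a0 ab b1;
    have [[a1 _ _] [a2 _ _]] := sp a b a0 ab b1; apply: ac_measurable_derive1.
have sh (a b : R) : 0 < a -> a <= b -> b < 1 -> sobolev a b h.
  move=> a0 ab b1; have [s1 s2] := sp a b a0 ab b1.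
  apply: sobolevM; [exact: ab| |].
  - apply: (@sobolev_lipschitz _ _ _ _ 2); [exact: ler0n| |].
      exact: ae_derivable_sub01.
    move=> s t /andP[as_ sb] /andP[at_ tb]; apply: Wlip.
      by rewrite (le_trans (ltW a0))//= (le_trans sb (ltW b1)).
    by rewrite (le_trans (ltW a0))//= (le_trans tb (ltW b1)).
  - apply: (@sobolev_dominated _ _ _ _ p1 p2 C);
      [exact: C0|exact: s1|exact: s2|exact: aeB|].
    by move=> s t _ _; exact: Bdom.
have dh : ae_derivable 0 1 h.
  by apply: ae_derivable_exhaust => a b a0 ab b1; have [] := sh a b a0 ab b1.
have mh : measurable_fun `]0 : R, 1 : R[ (derive1 h).
  apply: measurable_exhaust => a b a0 ab b1.
  by apply: ac_measurable_derive1; have [] := sh a b a0 ab b1.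
have mW : measurable_fun `]0 : R, 1 : R[ W.
  apply: open_continuous_measurable_fun; first exact: interval_open.
  move=> x; rewrite inE/= in_itv/= => x01.
  by apply: differentiable_continuous; apply/derivable1_diffP; exact: dW.
have [mp1 mp2] := mp; have [aep1 aep2] := aep.
have mWp : measurable_fun `]0 : R, 1 : R[
    (fun x => W x ^+ 2 * (derive1 p1 x ^+ 2 + derive1 p2 x ^+ 2)).
  apply: measurable_funM; first exact: measurable_funX.
  by apply: measurable_funD; exact: measurable_funX.
have Wp0 x : 0 <= W x ^+ 2 * (derive1 p1 x ^+ 2 + derive1 p2 x ^+ 2).
  by apply: mulr_ge0; [exact: sqr_ge0|apply: addr_ge0; exact: sqr_ge0].
have C40 : 0 <= 4 * C ^+ 2 by rewrite mulr_ge0// sqr_ge0.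
have eh : (energy 0 1 h < +oo)%E.
  apply: le_lt_trans (integral_affine_lty (ler0n _ 8) C40 mWp Wp0 Wfin).
  apply: ae_ge0_le_integral => //.
  - by move=> x _; rewrite lee_fin sqr_ge0.
  - exact: measurable_sqr_EFin.
  - by move=> x _; rewrite lee_fin addr_ge0// mulr_ge0.
  - apply/measurable_EFinP; apply: measurable_funD; first exact: measurable_cst.
    by apply: measurable_funM; first exact: measurable_cst.
  apply: ae_mono (ae_and aep1 aep2) => x [h1 h2] /= xin.
  have x01 : 0 < x < 1 by move: xin; rewrite in_itv.
  rewrite lee_fin; apply: derivative_weighted => //.
  - exact: dW.
  - by apply: dB; [exact: h1|exact: h2].
  - exact: h1.
  - exact: h2.
split; [|exact: dh|exact: eh].
pose u x := 2 + `|derive1 h x|.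
have mu_ : measurable_fun `]0 : R, 1 : R[ u.
  by apply: measurable_funD; [exact: measurable_cst|exact: measurableT_comp].
have u0 x : 0 <= u x by rewrite /u addr_ge0.
have mu_s (s t : R) : 0 <= s -> t <= 1 -> measurable_fun `]s, t[ (fun x => `|u x|%:E).
  move=> s0 t1; apply: measurable_normr_EFin; apply: measurable_funS mu_ => //.
  by apply: subset_itvW; rewrite ?bnd_simp.
have u2 (s t : R) : 0 <= s -> s <= t -> t <= 1 ->
    ((2 * (t - s))%:E <= \int[mu]_(x in `]s, t[) `|u x|%:E)%E.
  move=> s0 st t1.
  have -> : (2 * (t - s))%:E = (\int[mu]_(x in `]s, t[) cst 2%:E x)%E.
    rewrite integral_cst//= lebesgue_measure_itv/= lte_fin.
    by case: ltgtP st => // -> _; rewrite subrr mulr0 mule0.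
  apply: ge0_le_integral => //.
  - by move=> x _; rewrite lee_fin.
  - exact: mu_s.
  - by move=> x _; rewrite lee_fin ger0_norm// /u lerDl.
have hle x : `|h x| <= `|W x|.
  by rewrite /h normrM ler_piMr.
apply: (@ac_of_bound _ _ _ _ u) => //.
  apply: le_lt_trans (@integral_affine_lty 0 1 8 2 (fun x => derive1 h x ^+ 2) _ _ _ _ eh) => //.
  - apply: ge0_le_integral => //.
    + by move=> x _; rewrite lee_fin sqr_ge0.
    + exact: measurable_sqr_EFin.
    + apply/measurable_EFinP; apply: measurable_funD; first exact: measurable_cst.
      by apply: measurable_funM; [exact: measurable_cst|exact: measurable_funX].
    move=> x _; rewrite lee_fin /u -(real_normK (num_real (derive1 h x))).
    by have := sqr_ge0 (2 - `|derive1 h x|); rewrite !expr2 => ?; lra.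
  - exact: measurable_funX.
  - by move=> x; rewrite sqr_ge0.
move=> s t s0 st t1.
have W00 : W 0 = 0 by apply: W0; rewrite ltxx.
have W11 : W 1 = 0 by apply: W0; rewrite ltxx andbF.
have [s0'|sn0] := ltP 0 s; last first.
  have -> : s = 0 by apply/eqP; rewrite eq_le sn0.
  have t0 := le_trans s0 st.
  apply: le_trans (u2 0 t (lexx _) t0 t1).
  rewrite lee_fin -/(h t) -/(h 0) {2}/h W00 mul0r subr0 (le_trans (hle t))//.
  have := Wlip 0 t; rewrite W00 !subr0 (ger0_norm t0) lexx ler01 t0 t1.
  exact.
have [t1'|tn1] := ltP t 1; last first.
  have -> : t = 1 by apply/eqP; rewrite eq_le t1.
  have s1 := le_trans st t1.
  apply: le_trans (u2 s 1 s0 s1 (lexx _)).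
  rewrite lee_fin -/(h 1) -/(h s) {1}/h W11 mul0r sub0r normrN (le_trans (hle s))//.
  have := Wlip s 1; rewrite W11 sub0r normrN [`|1 - s|]ger0_norm ?subr_ge0// s0 s1 ler01 lexx.
  exact.
apply: le_trans (sobolev_increment (sh s t s0' st t1') (lexx _) st (lexx _)) _.
apply: ge0_le_integral => //.
- apply: measurable_normr_EFin; apply: measurable_derive1_sub mh => //.
- exact: mu_s.
- by move=> x _; rewrite lee_fin (ger0_norm (u0 x)) /u lerDr.
Qed.

(** The functions 1 / (1 + |z|^2), Re z / (1 + |z|^2) and Im z / (1 + |z|^2) are
Lipschitz: after clearing denominators each difference is a combination
(p - p') A + (q - q') E with A and E of size at most 3 D D'. *)
Lemma quotient_lipschitz (p q p' q' : R) :
  let D := 1 + p ^+ 2 + q ^+ 2 in let D' := 1 + p' ^+ 2 + q' ^+ 2 in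
  [/\ `|D^-1 - D'^-1| <= 3 * (`|p - p'| + `|q - q'|),
      `|p / D - p' / D'| <= 3 * (`|p - p'| + `|q - q'|) &
      `|q / D - q' / D'| <= 3 * (`|p - p'| + `|q - q'|)].
Proof.
move=> D D'.
have D1 : 1 <= D by rewrite /D -addrA lerDl addr_ge0 ?sqr_ge0.
have D'1 : 1 <= D' by rewrite /D' -addrA lerDl addr_ge0 ?sqr_ge0.
have D0 : 0 < D := lt_le_trans ltr01 D1.
have D'0 : 0 < D' := lt_le_trans ltr01 D'1.
have DD0 : 0 < D * D' by rewrite mulr_gt0.
have key x y A E : (x - y) * (D * D') = (p - p') * A + (q - q') * E ->
    `|A| <= 3 * (D * D') -> `|E| <= 3 * (D * D') ->
    `|x - y| <= 3 * (`|p - p'| + `|q - q'|).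
  move=> eq hA hE; rewrite -(ler_pM2r DD0).
  rewrite -{1}(ger0_norm (ltW DD0)) -normrM eq (le_trans (ler_normD _ _))//.
  rewrite !normrM mulrAC mulrDr lerD// mulrC ler_wpM2r//.
have np : `|p| <= D by rewrite /D ler_norml !expr2; apply/andP; split; nra.
have nq : `|q| <= D by rewrite /D ler_norml !expr2; apply/andP; split; nra.
have np' : `|p'| <= D' by rewrite /D' ler_norml !expr2; apply/andP; split; nra.
have nq' : `|q'| <= D' by rewrite /D' ler_norml !expr2; apply/andP; split; nra.
have DDD : D <= D * D' by rewrite ler_peMr// ltW.
have DDD' : D' <= D * D' by rewrite ler_peMl// ltW.
have prod x y : `|x| <= D -> `|y| <= D' -> `|x * y| <= D * D'.
  by move=> *; rewrite normrM ler_pM.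
have sq1 : p' ^+ 2 <= D' by rewrite /D' -addrA addrCA lerDl addr_ge0 ?sqr_ge0.
have sq2 : q' ^+ 2 <= D' by rewrite /D' lerDr addr_ge0 ?sqr_ge0.
have sq3 : `|p' * q'| <= D'.
  rewrite /D' ler_norml; have := sqr_ge0 (p' - q'); have := sqr_ge0 (p' + q').
  by rewrite !expr2 => ? ?; apply/andP; split; lra.
split.
- apply: (@key _ _ (- (p + p')) (- (q + q'))).
  + by rewrite /D /D'; field; rewrite -/D -/D' !gt_eqF.
  + by rewrite normrN (le_trans (ler_normD _ _))//; lra.
  + by rewrite normrN (le_trans (ler_normD _ _))//; lra.
- apply: (@key _ _ (1 - p * p' + q' ^+ 2) (- (p' * (q + q')))).
  + by rewrite /D /D'; field; rewrite -/D -/D' !gt_eqF.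
  + have h := prod _ _ np np'.
    rewrite (le_trans (ler_normD _ _))// (le_trans (lerD (ler_normB _ _) (lexx _)))//.
    by rewrite normr1 (ger0_norm (sqr_ge0 q')); lra.
  + have h := prod _ _ nq np'.
    rewrite normrN mulrDr [p' * q]mulrC (le_trans (ler_normD _ _))//; lra.
- apply: (@key _ _ (- (q' * (p + p'))) (1 - q * q' + p' ^+ 2)).
  + by rewrite /D /D'; field; rewrite -/D -/D' !gt_eqF.
  + have h := prod _ _ np nq'.
    rewrite normrN mulrDr [q' * p]mulrC [q' * p']mulrC (le_trans (ler_normD _ _))//; lra.
  + have h := prod _ _ nq nq'.
    rewrite (le_trans (ler_normD _ _))// (le_trans (lerD (ler_normB _ _) (lexx _)))//.
    by rewrite normr1 (ger0_norm (sqr_ge0 p')); lra.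
Qed.

Lemma quotient_bounded (p q : R) : let D := 1 + p ^+ 2 + q ^+ 2 in
  [/\ 0 < D, `|D^-1| <= 1, `|p / D| <= 1 & `|q / D| <= 1].
Proof.
move=> D.
have D1 : 1 <= D by rewrite /D -addrA lerDl addr_ge0 ?sqr_ge0.
have D0 : 0 < D := lt_le_trans ltr01 D1.
have np : `|p| <= D by rewrite /D ler_norml !expr2; apply/andP; split; nra.
have nq : `|q| <= D by rewrite /D ler_norml !expr2; apply/andP; split; nra.
split => //.
- by rewrite normfV (ger0_norm (ltW D0)) invf_le1.
- by rewrite normrM normfV (ger0_norm (ltW D0)) ler_pdivrMr// mul1r.
- by rewrite normrM normfV (ger0_norm (ltW D0)) ler_pdivrMr// mul1r.
Qed.

End weighted.

(** * A nonvanishing element of the domain *)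

Theorem theorem3p1 (R : realType) (phi : R -> R[i])
    (hphi : densely_defined_multiplier phi) :
  exists f : R -> R[i], mult_dom phi f /\
    forall x : R, 0 < x < 1 -> f x <> 0.
Proof.
pose p x := complex.Re (phi x); pose q x := complex.Im (phi x).
have sp (a b : R) : 0 < a -> a <= b -> b < 1 -> sobolev a b p /\ sobolev a b q.
  exact: multiplier_sobolev.
have mp : measurable_fun `]0 : R, 1 : R[ (derive1 p) /\
    measurable_fun `]0 : R, 1 : R[ (derive1 q).
  by split; apply: measurable_exhaust => a b a0 ab b1;
    have [[a1 _ _] [a2 _ _]] := sp a b a0 ab b1; apply: ac_measurable_derive1.
have [mp1 mp2] := mp.
pose v x := derive1 p x ^+ 2 + derive1 q x ^+ 2.
have v0 x : 0 <= v x by apply: addr_ge0; exact: sqr_ge0.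
have mv : measurable_fun `]0 : R, 1 : R[ v.
  by apply: measurable_funD; exact: measurable_funX.
have vfin (a : R) : 0 < a ->
    (\int[lebesgue_measure]_(x in `]a, (1 - a)%R[) (v x)%:E < +oo)%E.
  move=> a0; have [aa|aa] := leP a (1 - a); last first.
    by rewrite set_itv_ge ?integral_set0 ?ltry// bnd_simp -leNgt ltW.
  have a1 : 1 - a < 1 by lra.
  have [[acp _ ep] [acq _ eq]] := sp a _ a0 aa a1.
  have mEp := measurable_sqr_EFin (ac_measurable_derive1 acp).
  have mEq := measurable_sqr_EFin (ac_measurable_derive1 acq).
  have sq0 (u : R -> R) x : `]a, (1 - a)%R[%classic x -> (0 <= (u x ^+ 2)%:E)%E.
    by move=> _; rewrite lee_fin sqr_ge0.
  under eq_integral do rewrite EFinD.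
  rewrite ge0_integralD; [|exact: measurable_itv|exact: sq0|exact: mEp|exact: sq0|exact: mEq].
  by apply: lte_add_pinfty; [exact: ep|exact: eq].
have [W [Wp W0 dW Wlip Wfin]] := exists_weight v0 mv vfin.
pose D x := 1 + p x ^+ 2 + q x ^+ 2.
have D0 x : 0 < D x by have [] := quotient_bounded (p x) (q x).
have c3 : 0 <= 3 :> R by [].
have dD x : derivable p x 1 -> derivable q x 1 -> derivable (fun t => (D t)^-1) x 1.
  move=> dp dq; apply: derivableV; first by rewrite gt_eqF.
  have dsq (u : R -> R) : derivable u x 1 -> derivable (fun t => u t ^+ 2) x 1.
    move=> du; rewrite (_ : (fun t => u t ^+ 2) = u * u).
      exact: (derivableM du du).
    by apply/funext => t; rewrite expr2.
  exact: (derivableD (derivableD (derivable_cst (1 : R) x 1) (dsq _ dp)) (dsq _ dq)).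
have sW (B : R -> R) : (forall x, `|B x| <= 1) ->
    (forall s t, `|B t - B s| <= 3 * (`|p t - p s| + `|q t - q s|)) ->
    (forall x, derivable p x 1 -> derivable q x 1 -> derivable B x 1) ->
    sobolev 0 1 (fun x => W x * B x).
  move=> B1 Bl dB.
  exact: (weighted_sobolev c3 sp W0 dW Wlip Wfin B1 Bl dB).
have s0 : sobolev 0 1 (fun x => W x * (D x)^-1).
  apply: sW => [x|s t|x].
  - by have [] := quotient_bounded (p x) (q x).
  - by have [] := quotient_lipschitz (p t) (q t) (p s) (q s).
  - exact: dD.
have s1 : sobolev 0 1 (fun x => W x * (p x / D x)).
  apply: sW => [x|s t|x dp dq].
  - by have [] := quotient_bounded (p x) (q x).
  - by have [] := quotient_lipschitz (p t) (q t) (p s) (q s).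
  - by apply: derivableM; [exact: dp|exact: dD].
have s2 : sobolev 0 1 (fun x => W x * (q x / D x)).
  apply: sW => [x|s t|x dp dq].
  - by have [] := quotient_bounded (p x) (q x).
  - by have [] := quotient_lipschitz (p t) (q t) (p s) (q s).
  - by apply: derivableM; [exact: dq|exact: dD].
have W00 : W 0 = 0 by apply: W0; rewrite ltxx.
have W11 : W 1 = 0 by apply: W0; rewrite ltxx andbF.
(* W vanishes outside ]0, 1[, so that phi f is given by one formula on the line. *)
pose f x : R[i] := Complex (W x * (D x)^-1) 0.
have phif x : mult_op phi f x = Complex (W x * (p x / D x)) (W x * (q x / D x)).
  rewrite /mult_op; case: ifPn.
    move=> _; rewrite /f /p /q; case: (phi x) => u w /=.
    by congr Complex; ring.
  by rewrite in_itv/= => /W0 ->; rewrite !mul0r.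
exists f; split; last first.
  move=> x x01 [] /eqP; apply/negP.
  by rewrite mulf_neq0// ?invr_neq0// gt_eqF// Wp.
split; split.
- by apply: W12_of_sobolev; [exact: s0|exact: sobolev_cst].
- by rewrite /f W00 mul0r.
- by rewrite /f W11 mul0r.
- apply: W12_of_sobolev.
    by apply: sobolev_ext s1 => x _; rewrite phif.
  by apply: sobolev_ext s2 => x _; rewrite phif.
- by rewrite phif W00 !mul0r.
- by rewrite phif W11 !mul0r.
Qed.
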